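(* Let $K$ be a field, $n=3$, $x=(x_1,x_2,x_3)$, and let $H\in K[x]^3$ be quartic homogeneous (in particular nonzero) such that $\mathcal{J}H$ is nilpotent. If $\frac16\in K$, then there exists a $T\in\operatorname{GL}_3(K)$ such that for $\tilde H:=T^{-1}H(Tx)$, either $$\tilde H=\big(0,\ \tfrac14x_1^4,\ x_1^3x_2+u_3x_1^2x_2^2+v_3x_1x_2^3+w_3x_2^4\big)$$ for certain $u_3,v_3,w_3\in K$, or $$\tilde H=\big(0,\ \tfrac14x_1^4+u_2x_1^2x_3^2+v_2x_1x_3^3+w_2x_3^4,\ 0\big)$$ for certain $u_2,v_2,w_2\in K$.
   Context: $\mathcal{J}H=(\partial H_i/\partial x_j)_{i,j}$ is the Jacobian matrix with respect to $x$ (a column vector in matrix products); $H(Tx)$ denotes substitution of $Tx$ for $x$. Quartic homogeneous means that $H$ has degree $4$ and every nonzero component is homogeneous of degree $4$. $\frac16\in K$ means that the characteristic of $K$ is neither $2$ nor $3$. *)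

(* Defs.v *)
From mathcomp Require Export all_boot all_algebra.
From mathcomp Require Export mpoly.

Set Implicit Arguments.
Unset Strict Implicit.
Unset Printing Implicit Defensive.

Import GRing.Theory.
Local Open Scope ring_scope.

Definition polymap (n : nat) (K : fieldType) := 'cV[{mpoly K[n]}]_n.

Definition jacobian (n : nat) (K : fieldType) (H : polymap n K) :
    'M[{mpoly K[n]}]_n :=
  \matrix_(i, j) (H i 0)^`M(j).

Definition nilpotent_mx (R : pzRingType) (n : nat) (A : 'M[R]_n) : Prop :=
  exists k : nat, A ^+ k = 0.

(* [(msize p).-1] is the degree of [p], with the zero polynomial sent to 0;
   hence [polymap_deg H = d] with [d > 0] forces [H] to be nonzero. *)
Definition polymap_deg (n : nat) (K : fieldType) (H : polymap n K) : nat :=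
  \max_(i < n) (msize (H i ord0)).-1.

Definition quartic_homogeneous (n : nat) (K : fieldType) (H : polymap n K) :
    Prop :=
  polymap_deg H = 4%N /\ forall i : 'I_n, H i 0 != 0 -> H i 0 \is 4.-homog.

Definition subst_linear (n : nat) (K : fieldType) (T : 'M[K]_n)
    (H : polymap n K) : polymap n K :=
  \col_i (H i 0 \mPo [tuple \sum_(k < n) T j k *: 'X_k | j < n]).

(* T^-1 H(Tx) *)
Definition linear_conj (n : nat) (K : fieldType) (T : 'M[K]_n)
    (H : polymap n K) : polymap n K :=
  map_mx (@mpolyC n K) (invmx T) *m subst_linear T H.

Definition polymap3 (K : fieldType) (f1 f2 f3 : {mpoly K[3]}) : polymap 3 K :=
  \col_(i < 3) [:: f1; f2; f3]`_i.

(* Main.v *)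
Require Import Defs.
From mathcomp Require Import ring zify.

(* The Jacobian matrix A of H at a generic point a satisfies A a = 4 H(a) and
   A^3 = 0.  If A H(a) is nonzero, then a, H(a), A H(a) is a basis in which
   H = x1^4 e2 + x1^3 x2 e3 + (order >= 2 in x2, x3); comparing coefficients in
   tr JH = 0, det JH = 0 and the vanishing of the sum of the principal 2-minors
   gives H_1 = 0 and H_2 = x1^4.  If A H(a) = 0, then JH H = 0 because a is
   generic.  A solution w of A w = a would give a basis a, H(a), w in which the
   coefficients of tr JH and JH H cannot all vanish; hence A has rank one with
   image spanned by H(a), and H = f v for a constant vector v.  So over
   K(x1,x2,x3) there are independent linear forms l1, l2 with l1(H) = 0 and l2(H)
   a multiple of l1(x)^4.  These are linear relations between polynomials over K,
   so such forms exist over K.  In the corresponding coordinates H_1 = 0,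
   H_2 = d x1^4, and tr JH = 0 says that H_3 depends on x1, x2 only; a field of
   characteristic different from 2 and 3 has enough elements to bring this to
   one of the two normal forms. *)

Import GRing.Theory.
Local Open Scope ring_scope.

Set Implicit Arguments.
Unset Strict Implicit.
Unset Printing Implicit Defensive.

(** * Coefficient arrays *)

(* The array f stands for the quartic form p with p(1, x2, x3) the sum of the
   f j k * x2^j * x3^k; coefd0, coefd1, coefd2 are the arrays of its partial
   derivatives, dehomogenized in the same way.  In coefd0 the exponent 4 - j - k
   of x1 is truncated at 0, which is harmless since f j k = 0 when j + k > 4. *)
Section CoefficientArrays.
Variable R : comPzRingType.
Implicit Types f g : nat -> nat -> R.

Definition conv f g (j k : nat) : R :=
  \sum_(a <- iota 0 j.+1) \sum_(b <- iota 0 k.+1) f a b * g (j - a)%N (k - b)%N.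
Definition coefd0 f (j k : nat) := f j k *+ (4 - j - k).
Definition coefd1 f (j k : nat) := f j.+1 k *+ j.+1.
Definition coefd2 f (j k : nat) := f j k.+1 *+ k.+1.

Definition tr_coef f1 f2 f3 (j k : nat) : R :=
  coefd0 f1 j k + coefd1 f2 j k + coefd2 f3 j k.
Definition minor_coef f1 f2 f3 (j k : nat) : R :=
    (conv (coefd0 f1) (coefd1 f2) j k - conv (coefd1 f1) (coefd0 f2) j k)
  + (conv (coefd0 f1) (coefd2 f3) j k - conv (coefd2 f1) (coefd0 f3) j k)
  + (conv (coefd1 f2) (coefd2 f3) j k - conv (coefd2 f2) (coefd1 f3) j k).
Definition det_coef f1 f2 f3 (j k : nat) : R :=
    conv (coefd0 f1) (conv (coefd1 f2) (coefd2 f3)) j k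
  - conv (coefd0 f1) (conv (coefd2 f2) (coefd1 f3)) j k
  - conv (coefd0 f2) (conv (coefd1 f1) (coefd2 f3)) j k
  + conv (coefd0 f2) (conv (coefd2 f1) (coefd1 f3)) j k
  + conv (coefd0 f3) (conv (coefd1 f1) (coefd2 f2)) j k
  - conv (coefd0 f3) (conv (coefd2 f1) (coefd1 f2)) j k.

Definition coef_action f1 f2 f3 f (j k : nat) : R :=
  conv (coefd0 f) f1 j k + conv (coefd1 f) f2 j k + conv (coefd2 f) f3 j k.

End CoefficientArrays.

(** On numerals the bound [4 < j + k] computes to [true], so [isT] discharges it exactly for the
    entries of excessive degree. *)
Ltac drop_high fhigh :=
  match type of fhigh with
  | forall j k, _ -> ?f j k = 0 =>
      repeat match goal with
             | |- context [f ?j ?k] => rewrite (fhigh j k isT)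
             end
  end.

Ltac drop_high3 fhigh ghigh hhigh :=
  drop_high fhigh; drop_high ghigh; drop_high hhigh.

Ltac expand_coef :=
  rewrite ?/tr_coef ?/minor_coef ?/det_coef ?/coef_action ?/conv
    ?/coefd0 ?/coefd1 ?/coefd2 ?unlock /= ?(subSS, sub0n, subn0) ?mulr0n.

(** Solves a coefficient equation [e = 0] for one unknown: up to sign, [c] is the coefficient of
    that unknown in [e], and the last premise is an identity left to [ring] or [field]. *)
Lemma eq_of_scaled (F : fieldType) (c x y e : F) :
  c != 0 -> e = 0 -> c * (x - y) = e -> x = y.
Proof.
by move=> c0 -> /eqP; rewrite mulf_eq0 (negPf c0) /= subr_eq0 => /eqP.
Qed.

(** The integers inverted while solving the coefficient equations have no prime factor other than 2
    and 3. *)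
Lemma natr_smooth_neq0 (F : fieldType) (n2 : 2%:R != 0 :> F) (n3 : 3%:R != 0 :> F) a b :
  (2 ^ a * 3 ^ b)%:R != 0 :> F.
Proof. by rewrite natrM !natrX mulf_neq0 ?expf_neq0. Qed.

(* The initial values are those of H in the basis a, H(a), A H(a).  In degrees 1
   to 3 the equations are triangular in the coefficients other than q, al, be,
   ga, de below and those of x2^4 and of x2^3 in h3; a few equations of higher
   degree then kill q, al, ga, de, h1 4 0 and h2 4 0. *)
Lemma cyclic_coefs (F : fieldType) (h1 h2 h3 : nat -> nat -> F)
  (n2 : 2%:R != 0 :> F) (n3 : 3%:R != 0 :> F)
  (high1 : forall j k, (4 < j + k)%N -> h1 j k = 0)
  (high2 : forall j k, (4 < j + k)%N -> h2 j k = 0)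
  (high3 : forall j k, (4 < j + k)%N -> h3 j k = 0)
  (h100 : h1 0%N 0%N = 0) (h110 : h1 1%N 0%N = 0) (h101 : h1 0%N 1%N = 0)
  (h200 : h2 0%N 0%N = 1) (h210 : h2 1%N 0%N = 0) (h201 : h2 0%N 1%N = 0)
  (h300 : h3 0%N 0%N = 0) (h310 : h3 1%N 0%N = 1) (h301 : h3 0%N 1%N = 0)
  (tr0 : forall j k, tr_coef h1 h2 h3 j k = 0)
  (mi0 : forall j k, minor_coef h1 h2 h3 j k = 0)
  (det0 : forall j k, det_coef h1 h2 h3 j k = 0) :
  (forall j k, h1 j k = 0) /\ (forall j k, (0 < j + k)%N -> h2 j k = 0).
Proof.
have nz a b := natr_smooth_neq0 n2 n3 a b.
move hq : (h1 2%N 0%N) => q; move hal : (h2 2%N 0%N) => al.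
move hbe : (h3 2%N 0%N) => be; move hga : (h1 3%N 0%N) => ga.
move hde : (h2 3%N 0%N) => de.
pose E0 := (h100, h110, h101, h200, h210, h201, h300, h310, h301,
  hq, hal, hbe, hga, hde).
have h111 : h1 1%N 1%N = 0.
  apply: (eq_of_scaled (nz 2 0) (det0 1%N 0%N)).
  by expand_coef; rewrite ?E0; ring.
have h102 : h1 0%N 2%N = 0.
  apply: (eq_of_scaled (nz 3 0) (det0 0%N 1%N)).
  by expand_coef; rewrite ?E0; ring.
pose E11 := (E0, h111, h102).
have h211 : h2 1%N 1%N = - 8%:R * q.
  apply/esym/(eq_of_scaled (nz 0 0) (mi0 1%N 0%N)).
  by expand_coef; rewrite ?E11; ring.
have h202 : h2 0%N 2%N = 0.
  apply/esym/(eq_of_scaled (nz 1 0) (mi0 0%N 1%N)).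
  by expand_coef; rewrite ?E11; ring.
pose E12 := (E11, h211, h202).
have h311 : h3 1%N 1%N = - 2%:R * al.
  apply: (eq_of_scaled (nz 0 0) (tr0 1%N 0%N)).
  by expand_coef; rewrite ?E12; ring.
have h302 : h3 0%N 2%N = 4%:R * q.
  apply: (eq_of_scaled (nz 1 0) (tr0 0%N 1%N)).
  by expand_coef; rewrite ?E12; ring.
pose E13 := (E12, h311, h302).
have h121 : h1 2%N 1%N = - 4%:R * q * al.
  apply: (eq_of_scaled (nz 2 0) (det0 2%N 0%N)).
  by expand_coef; rewrite ?E13; ring.
have h112 : h1 1%N 2%N = 8%:R * q ^+ 2.
  apply: (eq_of_scaled (nz 3 0) (det0 1%N 1%N)).
  by expand_coef; rewrite ?E13; ring.
have h103 : h1 0%N 3%N = 0.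
  apply: (eq_of_scaled (nz 2 1) (det0 0%N 2%N)).
  by expand_coef; rewrite ?E13; ring.
pose E21 := (E13, h121, h112, h103).
have h221 : h2 2%N 1%N = 16%:R * q * be - 12%:R * ga - 4%:R * al ^+ 2.
  apply/esym/(eq_of_scaled (nz 0 0) (mi0 2%N 0%N)).
  by expand_coef; rewrite ?E21; ring.
have h212 : h2 1%N 2%N = 24%:R * q * al.
  apply/esym/(eq_of_scaled (nz 1 0) (mi0 1%N 1%N)).
  by expand_coef; rewrite ?E21; ring.
have h203 : h2 0%N 3%N = - 32%:R * q ^+ 2.
  apply/esym/(eq_of_scaled (nz 0 1) (mi0 0%N 2%N)).
  by expand_coef; rewrite ?E21; ring.
pose E22 := (E21, h221, h212, h203).
have h321 : h3 2%N 1%N = - 2%:R * q - 3%:R * de.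
  apply: (eq_of_scaled (nz 0 0) (tr0 2%N 0%N)).
  by expand_coef; rewrite ?E22; ring.
have h312 : h3 1%N 2%N = - 16%:R * q * be + 12%:R * ga + 4%:R * al ^+ 2.
  apply: (eq_of_scaled (nz 1 0) (tr0 1%N 1%N)).
  by expand_coef; rewrite ?E22; ring.
have h303 : h3 0%N 3%N = - 8%:R * q * al.
  apply: (eq_of_scaled (nz 0 1) (tr0 0%N 2%N)).
  by expand_coef; rewrite ?E22; ring.
pose E23 := (E22, h321, h312, h303).
have h131 : h1 3%N 1%N = 8%:R * q * al * be - 6%:R * q * de + 4%:R * q ^+ 2 - 6%:R * ga * al.
  apply: (eq_of_scaled (nz 2 0) (det0 3%N 0%N)).
  by expand_coef; rewrite ?E23; ring.
have h122 : h1 2%N 2%N = 36%:R * q * ga + 12%:R * q * al ^+ 2 - 48%:R * q ^+ 2 * be.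
  apply: (eq_of_scaled (nz 3 0) (det0 2%N 1%N)).
  by expand_coef; rewrite ?E23; ring.
have h113 : h1 1%N 3%N = - 32%:R * q ^+ 2 * al.
  apply: (eq_of_scaled (nz 2 1) (det0 1%N 2%N)).
  by expand_coef; rewrite ?E23; ring.
have h104 : h1 0%N 4%N = 16%:R * q ^+ 3.
  apply: (eq_of_scaled (nz 4 0) (det0 0%N 3%N)).
  by expand_coef; rewrite ?E23; ring.
pose E31 := (E23, h131, h122, h113, h104).
have h231 : h2 3%N 1%N = 4%:R * q * al - 32%:R * q * be ^+ 2
    + 24%:R * q * h3 3%N 0%N + 24%:R * ga * be
    - 16%:R * h1 4%N 0%N - 12%:R * al * de + 8%:R * al ^+ 2 * be.
  apply/esym/(eq_of_scaled (nz 0 0) (mi0 3%N 0%N)).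
  by expand_coef; rewrite ?E31; ring.
have h222 : h2 2%N 2%N = - 144%:R * q * al * be + 36%:R * q * de
    - 40%:R * q ^+ 2 + 72%:R * ga * al + 12%:R * al ^+ 3.
  apply/esym/(eq_of_scaled (nz 1 0) (mi0 2%N 1%N)).
  by expand_coef; rewrite ?E31; ring.
have h213 : h2 1%N 3%N = - 192%:R * q * ga - 64%:R * q * al ^+ 2 + 320%:R * q ^+ 2 * be.
  apply/esym/(eq_of_scaled (nz 0 1) (mi0 1%N 2%N)).
  by expand_coef; rewrite ?E31; ring.
have h204 : h2 0%N 4%N = 80%:R * q ^+ 2 * al.
  apply/esym/(eq_of_scaled (nz 2 0) (mi0 0%N 3%N)).
  by expand_coef; rewrite ?E31; ring.
pose E32 := (E31, h231, h222, h213, h204).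
have h331 : h3 3%N 1%N = - ga - 4%:R * h2 4%N 0%N.
  apply: (eq_of_scaled (nz 0 0) (tr0 3%N 0%N)).
  by expand_coef; rewrite ?E32; ring.
have h322 : h3 2%N 2%N = - 4%:R * q * al + 48%:R * q * be ^+ 2
    - 36%:R * q * h3 3%N 0%N - 36%:R * ga * be
    + 24%:R * h1 4%N 0%N + 18%:R * al * de - 12%:R * al ^+ 2 * be.
  apply: (eq_of_scaled (nz 1 0) (tr0 2%N 1%N)).
  by expand_coef; rewrite ?E32; ring.
have h313 : h3 1%N 3%N = 96%:R * q * al * be - 24%:R * q * de
    + 24%:R * q ^+ 2 - 48%:R * ga * al - 8%:R * al ^+ 3.
  apply: (eq_of_scaled (nz 0 1) (tr0 1%N 2%N)).
  by expand_coef; rewrite ?E32; ring.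
have h304 : h3 0%N 4%N = 48%:R * q * ga + 16%:R * q * al ^+ 2 - 80%:R * q ^+ 2 * be.
  apply: (eq_of_scaled (nz 2 0) (tr0 0%N 3%N)).
  by expand_coef; rewrite ?E32; ring.
pose E33 := (E32, h331, h322, h313, h304).

(* If q were nonzero, its powers could be cancelled. This determines [al], [ga] and [be], after
   which two equations give 9 de = 8 q and 9 de = 16 q, hence 8 q = 0. *)
have q_eq0 : q = 0.
  apply/eqP/negP => /negP q0.
  have qX0 n : q ^+ n != 0 by rewrite expf_neq0.
  have al0 : al = 0.
    apply: (eq_of_scaled (mulf_neq0 (nz 13 1) (qX0 5)) (det0 0%N 7%N)).
    by expand_coef; drop_high3 high1 high2 high3; rewrite ?E33; ring.
  have ga_be : ga = 2%:R * be * q.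
    apply/esym/(eq_of_scaled (mulf_neq0 (nz 10 1) (qX0 3)) (det0 0%N 5%N)).
    by expand_coef; drop_high3 high1 high2 high3; rewrite ?E33 ?al0; ring.
  have be0 : be = 0.
    apply/esym/(eq_of_scaled (mulf_neq0 (nz 9 1) (qX0 3)) (det0 1%N 3%N)).
    by expand_coef; drop_high3 high1 high2 high3; rewrite ?E33 ?ga_be ?al0; ring.
  have de1 : 9%:R * de = 8%:R * q.
    apply/esym/(eq_of_scaled (mulf_neq0 (nz 8 0) (qX0 3)) (mi0 0%N 5%N)).
    by expand_coef; drop_high3 high1 high2 high3; rewrite ?E33 ?ga_be ?be0 ?al0; ring.
  have de2 : 9%:R * de = 16%:R * q.
    apply/(eq_of_scaled (mulf_neq0 (nz 5 1) (qX0 2)) (det0 2%N 2%N)).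
    by expand_coef; drop_high3 high1 high2 high3; rewrite ?E33 ?ga_be ?be0 ?al0; ring.
  have : (2 ^ 3 * 3 ^ 0)%:R * q = 9%:R * de - 9%:R * de by rewrite {1}de2 de1; ring.
  by move/eqP; rewrite subrr mulf_eq0 (negPf q0) orbF (negPf (nz _ _)).
pose E4 := (E33, q_eq0).
have mi22 : 12%:R * al ^+ 2 * ga + 2%:R * al ^+ 4 + 9%:R * ga ^+ 2 = 0.
  apply/esym/(eq_of_scaled (nz 4 1) (mi0 2%N 2%N)).
  by expand_coef; drop_high3 high1 high2 high3; rewrite ?E4; ring.
have det31 : 2%:R * al ^+ 2 * ga + 3%:R * ga ^+ 2 = 0.
  apply/esym/(eq_of_scaled (nz 5 1) (det0 3%N 1%N)).
  by expand_coef; drop_high3 high1 high2 high3; rewrite ?E4; ring.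
have sq0 (x : F) : x ^+ 2 = 0 -> x = 0.
  by move/eqP; rewrite expf_eq0 => /eqP.
(* Eliminating ga^2 from the two equations leaves 2 al^2 (al^2 + 3 ga) = 0. Either factor, put back
   into [det31], gives ga^2 = 0. *)
have [al0 ga0] : al = 0 /\ ga = 0.
  have : al ^+ 2 * (al ^+ 2 + 3%:R * ga) = 0.
    have := congr2 (fun x y => x - 3%:R * y) mi22 det31.
    by rewrite mulr0 subr0 => /(eq_of_scaled (nz 1 0)); apply; ring.
  move/eqP; rewrite mulf_eq0 expf_eq0 /= => /orP[/eqP al0|].
    split=> //; apply: sq0.
    by apply: (eq_of_scaled (nz 0 1) det31); rewrite al0; ring.
  rewrite addr_eq0 => /eqP al2.
  have ga0 : ga = 0.
    apply/sq0/esym.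
    by apply: (eq_of_scaled (nz 0 1) det31); rewrite al2; ring.
  by split=> //; apply: sq0; rewrite al2 ga0 mulr0 oppr0.
pose E5 := (E4, al0, ga0).
(* From here on, each minor equation used is a constant multiple of the square of a single
   unknown. *)
have h140 : h1 4%N 0%N = 0.
  apply/sq0/esym/(eq_of_scaled (nz 9 1) (mi0 4%N 2%N)).
  by expand_coef; drop_high3 high1 high2 high3; rewrite ?E5; ring.
have de0 : de = 0.
  apply/sq0/esym/(eq_of_scaled (nz 0 2) (mi0 4%N 0%N)).
  by expand_coef; drop_high3 high1 high2 high3; rewrite ?E5 ?h140; ring.
have h240 : h2 4%N 0%N = 0.
  apply/sq0/esym/(eq_of_scaled (nz 4 0) (mi0 6%N 0%N)).
  by expand_coef; drop_high3 high1 high2 high3; rewrite ?E5 ?h140 ?de0; ring.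
(* The unknowns still free, such as [be], occur in h1 and h2 only next to a factor that is now
   zero. *)
split=> j k.
  case: (ltnP 4 (j + k)) => [/high1//|].
  by case: j => [|[|[|[|[|j]]]]] //; case: k => [|[|[|[|[|k]]]]] // _;
    rewrite ?h140 ?E5 ?de0; ring.
case: (ltnP 4 (j + k)) => [/high2//|].
by case: j => [|[|[|[|[|j]]]]] //; case: k => [|[|[|[|[|k]]]]] // _ _;
  rewrite ?h240 ?h140 ?E5 ?de0 ?h140; ring.
Qed.

(* The initial values are those of H in the basis a, H(a), w with A w = a.  The
   coefficient of x2^2 x3^5 in the last entry of JH H turns out to be 3/4. *)
Lemma quasi_translation_coefs (F : fieldType) (h1 h2 h3 : nat -> nat -> F)
  (n2 : 2%:R != 0 :> F) (n3 : 3%:R != 0 :> F)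
  (high1 : forall j k, (4 < j + k)%N -> h1 j k = 0)
  (high2 : forall j k, (4 < j + k)%N -> h2 j k = 0)
  (high3 : forall j k, (4 < j + k)%N -> h3 j k = 0)
  (h100 : h1 0%N 0%N = 0) (h110 : h1 1%N 0%N = 0) (h101 : h1 0%N 1%N = 1)
  (h200 : h2 0%N 0%N = 1) (h210 : h2 1%N 0%N = 0) (h201 : h2 0%N 1%N = 0)
  (h300 : h3 0%N 0%N = 0) (h310 : h3 1%N 0%N = 0) (h301 : h3 0%N 1%N = 0)
  (tr0 : forall j k, tr_coef h1 h2 h3 j k = 0)
  (act1 : forall j k, coef_action h1 h2 h3 h1 j k = 0)
  (act2 : forall j k, coef_action h1 h2 h3 h2 j k = 0)
  (act3 : forall j k, coef_action h1 h2 h3 h3 j k = 0) : False.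
Proof.
have nz a b := natr_smooth_neq0 n2 n3 a b.
pose E0 := (h100, h110, h101, h200, h210, h201, h300, h310, h301).
have h120 : h1 2%N 0%N = 0.
  by apply: (eq_of_scaled (nz 1 0) (act1 1%N 0%N)); expand_coef; rewrite ?E0; ring.
have h111 : h1 1%N 1%N = 0.
  by apply: (eq_of_scaled (nz 0 0) (act1 0%N 1%N)); expand_coef; rewrite ?E0; ring.
have h220 : h2 2%N 0%N = 0.
  by apply: (eq_of_scaled (nz 1 0) (act2 1%N 0%N)); expand_coef; rewrite ?E0; ring.
have h211 : h2 1%N 1%N = - 4%:R.
  by apply: (eq_of_scaled (nz 0 0) (act2 0%N 1%N)); expand_coef; rewrite ?E0; ring.
have h320 : h3 2%N 0%N = 0.
  by apply: (eq_of_scaled (nz 1 0) (act3 1%N 0%N)); expand_coef; rewrite ?E0; ring.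
have h311 : h3 1%N 1%N = 0.
  by apply: (eq_of_scaled (nz 0 0) (act3 0%N 1%N)); expand_coef; rewrite ?E0; ring.
pose E1 := (E0, h120, h111, h220, h211, h320, h311).
have h302 : h3 0%N 2%N = 2%:R^-1.
  by apply: (eq_of_scaled (nz 1 0) (tr0 0%N 1%N)); expand_coef; rewrite ?E1; field.
pose E2 := (E1, h302).
have h130 : h1 3%N 0%N = 0.
  by apply: (eq_of_scaled (nz 0 1) (act1 2%N 0%N)); expand_coef; rewrite ?E2; field.
have h121 : h1 2%N 1%N = 0.
  by apply: (eq_of_scaled (nz 1 0) (act1 1%N 1%N)); expand_coef; rewrite ?E2; field.
have h112 : h1 1%N 2%N = - 7%:R / 2%:R.
  by apply: (eq_of_scaled (nz 0 0) (act1 0%N 2%N)); expand_coef; rewrite ?E2; field.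
have h230 : h2 3%N 0%N = 0.
  by apply: (eq_of_scaled (nz 0 1) (act2 2%N 0%N)); expand_coef; rewrite ?E2; field.
have h221 : h2 2%N 1%N = 0.
  by apply: (eq_of_scaled (nz 1 0) (act2 1%N 1%N)); expand_coef; rewrite ?E2; field.
have h330 : h3 3%N 0%N = 0.
  by apply: (eq_of_scaled (nz 0 1) (act3 2%N 0%N)); expand_coef; rewrite ?E2; field.
have h321 : h3 2%N 1%N = 0.
  by apply: (eq_of_scaled (nz 1 0) (act3 1%N 1%N)); expand_coef; rewrite ?E2; field.
have h312 : h3 1%N 2%N = 0.
  by apply: (eq_of_scaled (nz 0 0) (act3 0%N 2%N)); expand_coef; rewrite ?E2; field.
pose E3 := (E2, h130, h121, h112, h230, h221, h330, h321, h312).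
have h122 : h1 2%N 2%N = 0.
  by apply: (eq_of_scaled (nz 1 0) (act1 1%N 2%N)); expand_coef; rewrite ?E3; field.
have h222 : h2 2%N 2%N = 4%:R.
  by apply: (eq_of_scaled (nz 1 0) (act2 1%N 2%N)); expand_coef; rewrite ?E3; field.
have h331 : h3 3%N 1%N = 0.
  by apply: (eq_of_scaled (nz 0 1) (act3 2%N 1%N)); expand_coef; rewrite ?E3; field.
have h322 : h3 2%N 2%N = 0.
  by apply: (eq_of_scaled (nz 1 0) (act3 1%N 2%N)); expand_coef; rewrite ?E3; field.
have h313 : h3 1%N 3%N = - 3%:R / 2%:R.
  by apply: (eq_of_scaled (nz 0 0) (act3 0%N 3%N)); expand_coef; rewrite ?E3; field.
pose E4 := (E3, h122, h222, h331, h322, h313).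
have : (2 ^ 0 * 3 ^ 1)%:R = 0 :> F.
  apply: (eq_of_scaled (mulf_neq0 (invr_neq0 n2) (invr_neq0 n2)) (act3 2%N 5%N)).
  by expand_coef; drop_high3 high1 high2 high3; rewrite ?E4; field.
by move/eqP; rewrite (negPf (nz _ _)).
Qed.

(* The entry (0, 0) is 1 for [g] and 0 for [f], so comparing coefficients of
   f g' = g f' shows that the lowest nonzero homogeneous part of f is constant. *)
Lemma eq0_of_dlog_coef (F : fieldType) (f g : nat -> nat -> F)
  (n2 : 2%:R != 0 :> F) (n3 : 3%:R != 0 :> F)
  (fhigh : forall j k, (4 < j + k)%N -> f j k = 0)
  (f0 : f 0%N 0%N = 0) (g0 : g 0%N 0%N = 1)
  (eq1 : forall j k, conv f (coefd1 g) j k = conv g (coefd1 f) j k)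
  (eq2 : forall j k, conv f (coefd2 g) j k = conv g (coefd2 f) j k) :
  forall j k, f j k = 0.
Proof.
have low n : (n <= 4)%N -> forall j k, (j + k <= n)%N -> f j k = 0.
  elim: n => [_ [|//] [|//] _ //|n IH n4 j k].
  rewrite leq_eqVlt ltnS => /predU1P[jk|/(IH (ltnW n4))//].
  (* In degree n, a product with f vanishes by induction ([conv0]), while the product of g with a
     derivative of f sees only the constant term 1 of g ([conv1]). So the derivatives of f vanish in
     degree n. *)
  have conv0 (u w : nat -> nat -> F) a b : (a + b <= n)%N ->
      (forall a' b', (a' + b' <= n)%N -> u a' b' = 0) -> conv u w a b = 0.
    move=> ab u0; rewrite /conv big_seq big1 // => a'; rewrite mem_iota add0n => /andP[_ a'a].
    rewrite big_seq big1 // => b'; rewrite mem_iota add0n => /andP[_ b'b].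
    by rewrite u0 ?mul0r // (leq_trans _ ab) // leq_add.
  have conv1 (w : nat -> nat -> F) a b :
      (forall a' b', (a' + b' < a + b)%N -> w a' b' = 0) -> conv g w a b = w a b.
    move=> w0; rewrite /conv /= big_cons /= big_cons g0 mul1r !subn0.
    rewrite big_seq big1 ?addr0 => [|b'].
      rewrite big_seq big1 ?addr0 // => a'; rewrite mem_iota => /andP[a'0 a'a].
      rewrite big_seq big1 // => b'; rewrite (mem_iota 0 b.+1) => /andP[_ b'b].
      by rewrite w0 ?mulr0 //; lia.
    rewrite mem_iota => /andP[b'0 b'b]; rewrite w0 ?mulr0 //; lia.
  (* Differentiation multiplies an entry by an exponent between 1 and 4, which is invertible. *)
  have cancel m : (0 < m <= 4)%N -> f j k *+ m = 0 -> f j k = 0.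
    move=> m4 /eqP; rewrite -mulr_natr mulf_eq0 => /orP[/eqP//|].
    by case: m m4 => [|[|[|[|[|m]]]]] // _;
      rewrite ?oner_eq0 ?(negPf n2) ?(negPf n3) // (natrM _ 2 2) mulf_eq0 (negPf n2).
  (* The derivative in x2 is used when the exponent of x2 is positive, the one in x3 otherwise. *)
  case: j jk cancel => [|j] jk cancel.
    case: k jk cancel => [//|k] jk cancel; apply: (cancel k.+1); first by lia.
    rewrite -[LHS]/(coefd2 f 0 k) -conv1 -?eq2 ?(conv0 f) //; first by lia.
      exact: IH (ltnW n4).
    by move=> a' b' ab; rewrite /coefd2 (IH (ltnW n4)) ?mul0rn //; lia.
  apply: (cancel j.+1); first by lia.
  rewrite -[LHS]/(coefd1 f j k) -conv1 -?eq1 ?(conv0 f) //; first by lia.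
    exact: IH (ltnW n4).
  by move=> a' b' ab; rewrite /coefd1 (IH (ltnW n4)) ?mul0rn //; lia.
by move=> j k; case: (ltnP 4 (j + k)) => [/fhigh|/low->].
Qed.

Local Notation i0 := (@Ordinal 3 0 isT).
Local Notation i1 := (@Ordinal 3 1 isT).
Local Notation i2 := (@Ordinal 3 2 isT).

(** * Polynomial maps and linear changes of variables *)

Lemma sum_ord3 (V : nmodType) (f : 'I_3 -> V) :
  \sum_(i < 3) f i = f i0 + (f i1 + f i2).
Proof.
rewrite !big_ord_recl big_ord0 addr0.
by congr (f _ + (f _ + f _)); apply/val_inj.
Qed.

Lemma prod_ord3 (R : pzSemiRingType) (f : 'I_3 -> R) :
  \prod_(i < 3) f i = f i0 * (f i1 * f i2).
Proof.
rewrite !big_ord_recl big_ord0 mulr1.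
by congr (f _ * (f _ * f _)); apply/val_inj.
Qed.

Lemma forall_ord3 (P : 'I_3 -> Prop) : P i0 -> P i1 -> P i2 -> forall i, P i.
Proof.
move=> p0 p1 p2 [[|[|[|//]]] lti].
- by rewrite (_ : Ordinal lti = i0) //; apply: val_inj.
- by rewrite (_ : Ordinal lti = i1) //; apply: val_inj.
- by rewrite (_ : Ordinal lti = i2) //; apply: val_inj.
Qed.

Lemma mpoly_ring_ind (n : nat) (R : nzRingType) (P : {mpoly R[n]} -> Prop) :
  (forall c, P c%:MP) -> (forall i, P 'X_i) ->
  (forall p q, P p -> P q -> P (p + q)) -> (forall p q, P p -> P q -> P (p * q)) ->
  forall p, P p.
Proof.
move=> PC PX PD PM p; rewrite [p]mpolyE; apply: big_ind => [||m _] //.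
  by rewrite -mpolyC0.
rewrite -mul_mpolyC; apply: (PM) => //; rewrite mpolyXE_id.
apply: big_ind => [||i _] //.
  by rewrite -mpolyC1.
elim: (m i) => [|k IH]; first by rewrite expr0 -mpolyC1.
by rewrite exprS; apply: PM.
Qed.

Section Derivatives.
Variables (n : nat) (R : comNzRingType).
Implicit Types p q : {mpoly R[n]}.

(** The chain rule: both sides are additive and obey the same product rule, so constants and
    variables suffice. *)
Lemma mderiv_comp_mpoly (t : n.-tuple {mpoly R[n]}) p (j : 'I_n) :
  (p \mPo t)^`M(j) = \sum_(i < n) (p^`M(i) \mPo t) * (tnth t i)^`M(j).
Proof.
elim/mpoly_ring_ind: p => [c|i|p q IHp IHq|p q IHp IHq].
- rewrite comp_mpolyC mderivC big1 // => i _.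
  by rewrite mderivC -(mpolyC0 _ R) comp_mpolyC mpolyC0 mul0r.
- rewrite comp_mpolyXU -tnth_nth (bigD1 i) //= big1 ?addr0 => [|k ki].
    rewrite mderivX mnm1E eqxx scale1r.
    by rewrite (_ : (_ - _)%MM = 0%MM) ?mpolyX0 ?comp_mpoly1 ?mul1r //
      -[X in (X - _)%MM]add0m addmK.
  by rewrite mderivX mnm1E eq_sym (negPf ki) scale0r comp_mpoly0 mul0r.
- rewrite !raddfD /= IHp IHq -big_split /=; apply: eq_bigr => i _.
  by rewrite raddfD raddfD mulrDl.
- rewrite rmorphM /= !mderivM IHp IHq mulr_suml mulr_sumr -big_split /=.
  apply: eq_bigr => i _; rewrite mderivM rmorphD !rmorphM /=.
  by rewrite mulrDl mulrAC -!mulrA.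
Qed.

Lemma comp_mpolyA (s t : n.-tuple {mpoly R[n]}) p :
  (p \mPo s) \mPo t = p \mPo [tuple tnth s i \mPo t | i < n].
Proof.
elim/mpoly_ring_ind: p => [c|i|p q IHp IHq|p q IHp IHq].
- by rewrite !comp_mpolyC.
- by rewrite !comp_mpolyXU -!tnth_nth tnth_mktuple.
- by rewrite !raddfD /= IHp IHq.
- by rewrite !rmorphM /= IHp IHq.
Qed.

Lemma mderiv_homog d p i : p \is d.+1.-homog -> p^`M(i) \is d.-homog.
Proof.
move=> /dhomogP hp; apply/dhomogP => m; rewrite mcoeff_msupp mcoeff_mderiv => nz.
have /hp : (m + U_(i))%MM \in msupp p.
  by rewrite mcoeff_msupp; apply: contraNneq nz => ->; rewrite mul0rn.
by rewrite /= mdegD mdeg1 addn1 => -[].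
Qed.

Lemma euler_homog d p : p \is d.-homog -> \sum_(i < n) 'X_i * p^`M(i) = p *+ d.
Proof.
move=> hp; rewrite {1 2}[p]mpolyE.
under eq_bigr => i _ do rewrite raddf_sum mulr_sumr.
rewrite exchange_big /= -sumrMnl; rewrite big_seq [RHS]big_seq; apply: eq_bigr => m mp.
rewrite -(dhomog_mf hp mp) /= mdegE -sumrMnr; apply: eq_bigr => i _.
rewrite mderivZ mderivX -!scalerAr.
(* When x_i is absent, subtraction of exponents truncates and x_i cannot be multiplied back; the
   coefficient is 0 then. *)
have [->|mi] := eqVneq (m i) 0%N; first by rewrite scale0r scaler0 mulr0n.
rewrite -mpolyXD addmC submK ?scaler_nat ?scalerMnr //.
by rewrite lep1mP.
Qed.

Lemma comp_mpoly_homog (t : n.-tuple {mpoly R[n]}) d p :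
  (forall i, tnth t i \is 1.-homog) -> p \is d.-homog -> p \mPo t \is d.-homog.
Proof.
move=> ht hp; rewrite comp_mpolyEX big_seq; apply: rpred_sum => m mp.
apply: dhomogZ; rewrite comp_mpolyX -(dhomog_mf hp mp) /= mdegE.
elim/big_rec2: _ => [|i u d' _ IH]; first exact: dhomog1.
by apply: dhomogM => //; have := dhomogMn (m i) (ht i); rewrite mul1n.
Qed.

End Derivatives.

Section LinearChange.
Variables (n : nat) (K : fieldType).
Implicit Types (T S : 'M[K]_n) (H : polymap n K) (p : {mpoly K[n]}).

Definition linear_forms T : n.-tuple {mpoly K[n]} :=
  [tuple \sum_(k < n) T j k *: 'X_k | j < n].

Lemma linear_forms1 : linear_forms 1%:M = [tuple 'X_i | i < n].
Proof.
apply/eq_from_tnth => i; rewrite !tnth_mktuple (bigD1 i) //= big1 ?addr0.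
  by rewrite mxE eqxx scale1r.
by move=> k ki; rewrite mxE eq_sym (negPf ki) scale0r.
Qed.

Lemma comp_linear_forms T S p :
  (p \mPo linear_forms T) \mPo linear_forms S = p \mPo linear_forms (T *m S).
Proof.
rewrite comp_mpolyA; congr (_ \mPo _); apply/eq_from_tnth => i.
rewrite !tnth_mktuple raddf_sum /=.
under eq_bigr => k _ do rewrite comp_mpolyZ comp_mpolyXU -tnth_nth tnth_mktuple scaler_sumr.
rewrite exchange_big; apply: eq_bigr => l _; rewrite mxE scaler_suml.
by apply: eq_bigr => k _; rewrite scalerA.
Qed.

Lemma linear_forms_homog T i : tnth (linear_forms T) i \is 1.-homog.
Proof.
rewrite tnth_mktuple; apply: rpred_sum => k _; apply: dhomogZ.
by rewrite dhomogX /= mdeg1.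
Qed.

Lemma mderiv_linear_forms T i j : (tnth (linear_forms T) i)^`M(j) = (T i j)%:MP.
Proof.
rewrite tnth_mktuple raddf_sum (bigD1 j) //= big1 ?addr0 => [|k kj].
  rewrite mderivZ mderivX mnm1E eqxx scale1r.
  by rewrite (_ : (_ - _)%MM = 0%MM) ?mpolyX0 ?alg_mpolyC // -[X in (X - _)%MM]add0m addmK.
by rewrite mderivZ mderivX mnm1E (negPf kj) scale0r scaler0.
Qed.

Lemma linear_conjE T H i :
  linear_conj T H i 0 =
  \sum_(k < n) (invmx T i k)%:MP * (H k 0 \mPo linear_forms T).
Proof. by rewrite !mxE; apply: eq_bigr => k _; rewrite !mxE. Qed.

Lemma linear_conj_unique T H (H' : polymap n K) : T \in unitmx ->
  subst_linear T H = map_mx (@mpolyC n K) T *m H' -> linear_conj T H = H'.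
Proof.
move=> uT e; rewrite /linear_conj e mulmxA -map_mxM mulVmx // map_mx1.
by rewrite mul1mx.
Qed.

Lemma subst_linear_conj T H : T \in unitmx ->
  subst_linear T H = map_mx (@mpolyC n K) T *m linear_conj T H.
Proof.
by move=> uT; rewrite mulmxA -map_mxM mulmxV // map_mx1 mul1mx.
Qed.

Lemma linear_conj_comp T S H : T \in unitmx -> S \in unitmx ->
  linear_conj S (linear_conj T H) = linear_conj (T *m S) H.
Proof.
move=> uT uS; apply/esym/linear_conj_unique; first by rewrite unitmx_mul uT.
rewrite map_mxM -mulmxA -subst_linear_conj //.
apply/colP => i; rewrite !mxE -/(linear_forms _) -comp_linear_forms.
have /matrixP/(_ i 0) := subst_linear_conj H uT; rewrite !mxE => ->.
rewrite raddf_sum; apply: eq_bigr => k _; rewrite !mxE.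
by rewrite /= rmorphM /= comp_mpolyC.
Qed.

Lemma jacobian_linear_conj T H :
  jacobian (linear_conj T H) =
  map_mx (@mpolyC n K) (invmx T)
    *m map_mx (comp_mpoly (linear_forms T)) (jacobian H)
    *m map_mx (@mpolyC n K) T.
Proof.
apply/matrixP => i j; rewrite -mulmxA [LHS]mxE linear_conjE [RHS]mxE raddf_sum.
apply: eq_bigr => k _; rewrite !mxE /= mderivM mderivC mul0r add0r.
congr (_ * _); rewrite mderiv_comp_mpoly; apply: eq_bigr => l _.
by rewrite mderiv_linear_forms !mxE.
Qed.

Lemma nilpotent_linear_conj T H : T \in unitmx ->
  nilpotent_mx (jacobian H) -> nilpotent_mx (jacobian (linear_conj T H)).
Proof.
move=> uT [k Hk]; exists k; rewrite jacobian_linear_conj.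
set P := map_mx _ (invmx T); set Q := map_mx _ T; set A := map_mx _ _.
have QP : Q *m P = 1%:M by rewrite -map_mxM mulmxV // map_mx1.
have PQ : P *m Q = 1%:M by rewrite -map_mxM mulVmx // map_mx1.
have expA m : (P *m A *m Q) ^+ m = P *m (A ^+ m) *m Q.
  elim: m => [|m IH]; first by rewrite !expr0 mulmx1 PQ.
  by rewrite !exprS IH -!mulmxE -!mulmxA (mulmxA Q P) QP mul1mx.
have mapX m : map_mx (comp_mpoly (linear_forms T)) (jacobian H ^+ m) = A ^+ m.
  elim: m => [|m IH]; first by rewrite !expr0 map_mx1.
  by rewrite !exprS -IH -!mulmxE map_mxM.
by rewrite expA -mapX Hk map_mx0 mulmx0 mul0mx.
Qed.

Lemma homog_linear_conj T H d : (forall i, H i 0 \is d.-homog) ->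
  forall i, linear_conj T H i 0 \is d.-homog.
Proof.
move=> hH i; rewrite linear_conjE; apply: rpred_sum => k _.
rewrite mul_mpolyC; apply: dhomogZ; apply: comp_mpoly_homog => //.
exact: linear_forms_homog.
Qed.

Lemma linear_conj_neq0 T H : T \in unitmx -> H != 0 -> linear_conj T H != 0.
Proof.
move=> uT; apply: contraNneq => e0; apply/eqP/colP => i.
have /matrixP/(_ i 0) : subst_linear T H = 0 by rewrite subst_linear_conj // e0 mulmx0.
rewrite !mxE -/(linear_forms _) => /(congr1 (comp_mpoly (linear_forms (invmx T)))).
by rewrite comp_linear_forms mulmxV // linear_forms1 comp_mpoly_id comp_mpoly0.
Qed.

Lemma meval_linear_conj T H (u : 'I_n -> K) i :
  (linear_conj T H i 0).@[u] =
  \sum_(k < n) invmx T i k * (H k 0).@[fun j => \sum_(l < n) T j l * u l].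
Proof.
rewrite linear_conjE raddf_sum; apply: eq_bigr => k _.
rewrite /= rmorphM /= mevalC comp_mpoly_meval; congr (_ * _).
apply: meval_eq => j; rewrite tnth_mktuple raddf_sum; apply: eq_bigr => l _.
by rewrite /= mevalZ mevalXU.
Qed.

End LinearChange.

(** * Nilpotent matrices *)

(* X^(k n) = det (X^k - A^k) is a multiple of det (X - A). *)
Lemma char_poly_nilpotent (R : idomainType) n (A : 'M[R]_n) :
  nilpotent_mx A -> char_poly A = 'X^n.
Proof.
case=> k Ak0.
have comm : GRing.comm ('X%:M) (map_mx (@polyC R) A).
  by rewrite /GRing.comm -!mulmxE scalar_mxC.
have dvd : char_poly A %| 'X^(k * n).
  have e : ('X%:M : 'M[{poly R}]_n) ^+ k =
      char_poly_mx A * \sum_(i < k) 'X%:M ^+ (k.-1 - i) * map_mx (@polyC R) A ^+ i.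
    have expA m : map_mx (@polyC R) (A ^+ m) = map_mx (@polyC R) A ^+ m.
      elim: m => [|m IH]; first by rewrite !expr0 map_mx1.
      by rewrite !exprS -IH -!mulmxE map_mxM.
    have := subrXX_comm k comm; rewrite -expA Ak0 map_mx0 subr0 => ->.
    by congr (_ * _); apply: eq_bigr => i _; rewrite subnS predn_sub.
  have scalarX m : ('X%:M : 'M[{poly R}]_n) ^+ m = ('X^m)%:M.
    by elim: m => [|m IH]; rewrite ?expr0 // !exprS IH -mulmxE -scalar_mxM.
  have := congr1 determinant e.
  by rewrite scalarX det_scalar det_mulmx -exprM => ->; apply: dvdp_mulIl.
(* A divisor of a power of X is associated to a power of X; being monic of degree n, it is X^n. *)
have : exists2 m, (m <= k * n)%N & char_poly A %= ('X - 0%:P) ^+ m.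
  by apply/dvdp_exp_XsubCP; rewrite subr0.
rewrite subr0 => -[m _ eqm].
have := eqp_size eqm; rewrite size_char_poly size_polyXn => -[nm].
move: eqm; rewrite -nm => eqm; apply/eqP.
by rewrite -eqp_monic ?char_poly_monic ?monicXn.
Qed.

Lemma mxtrace_nilpotent (R : idomainType) n (A : 'M[R]_n) :
  nilpotent_mx A -> \tr A = 0.
Proof.
case: n A => [A _|n A nA]; first by rewrite /mxtrace big_ord0.
apply/oppr_inj; rewrite -char_poly_trace // char_poly_nilpotent // coefXn oppr0.
by rewrite ltn_eqF.
Qed.

Lemma det_nilpotent (R : idomainType) n (A : 'M[R]_n.+1) :
  nilpotent_mx A -> \det A = 0.
Proof.
move=> nA; apply/eqP; have := char_poly_det A.
rewrite char_poly_nilpotent // coefXn => /esym/eqP.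
by rewrite mulrI_eq0 //; apply/lregX/lregN/lreg1.
Qed.

Lemma nilpotent_expn (R : idomainType) n (A : 'M[R]_n.+1) :
  nilpotent_mx A -> A ^+ n.+1 = 0.
Proof.
move=> nA; have := Cayley_Hamilton A.
by rewrite char_poly_nilpotent // rmorphXn /= horner_mx_X.
Qed.

Lemma det_mx33 (R : comPzRingType) (A : 'M[R]_3) :
  \det A = A i0 i0 * (A i1 i1 * A i2 i2) - A i0 i0 * (A i1 i2 * A i2 i1)
    - A i1 i0 * (A i0 i1 * A i2 i2) + A i1 i0 * (A i0 i2 * A i2 i1)
    + A i2 i0 * (A i0 i1 * A i1 i2) - A i2 i0 * (A i0 i2 * A i1 i1).
Proof.
rewrite (expand_det_col A i0) sum_ord3 /cofactor.
rewrite !(expand_det_col _ 0) !big_ord_recl !big_ord0 /cofactor !det_mx11 !mxE.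
(* Indexing by naturals makes the lifted indices of the minors compute, so that [ring] recognizes
   equal entries. *)
pose B a b := A (inord a) (inord b).
have AE i j : A i j = B i j by rewrite /B !inord_val.
by rewrite !AE /= /bump /=; ring.
Qed.

(* tr (A ^+ 2) = (tr A) ^+ 2 - 2 * (sum of the principal 2-minors). *)
Lemma minors_nilpotent3 (R : idomainType) (A : 'M[R]_3) :
  2%:R != 0 :> R -> nilpotent_mx A ->
  (A i0 i0 * A i1 i1 - A i0 i1 * A i1 i0) + (A i0 i0 * A i2 i2 - A i0 i2 * A i2 i0)
    + (A i1 i1 * A i2 i2 - A i1 i2 * A i2 i1) = 0.
Proof.
move=> n2 nA; have trA := mxtrace_nilpotent nA.
have trA2 : \tr (A *m A) = 0.
  apply: mxtrace_nilpotent; exists 2%N.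
  rewrite mulmxE -expr2 -exprM -[(2 * 2)%N]/(3 + 1)%N exprD.
  by rewrite nilpotent_expn // mul0r.
have [] : (\tr A = 0) /\ (\tr (A *m A) = 0) by [].
rewrite /mxtrace !sum_ord3 !mxE !sum_ord3 => e1 e2.
have := congr2 (fun x y => x * x - y) e1 e2.
by rewrite mulr0 subr0 => e; apply: (mulfI n2); rewrite mulr0 -[RHS]e; ring.
Qed.

(** * Coefficients of the Jacobian matrix *)

Definition mnm3 (a b c : nat) : 'X_{1..3} := [multinom nth 0%N [:: a; b; c] i | i < 3].

Lemma mnm3E (m : 'X_{1..3}) : m = mnm3 (m i0) (m i1) (m i2).
Proof. by apply/mnmP; apply: forall_ord3; rewrite mnmE. Qed.

Lemma mdeg_mnm3 (m : 'X_{1..3}) : mdeg m = (m i0 + (m i1 + m i2))%N.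
Proof. by rewrite mdegE (sum_ord3 (fun i => m i)). Qed.

Section Dehomogenization.
Variable R : comNzRingType.
Implicit Types p q : {mpoly R[3]}.

(** Sends x1 to 1, x2 to the outer and x3 to the inner variable. *)
Definition dehom : {mpoly R[3]} -> {poly {poly R}} :=
  mmap (polyC \o polyC) (fun i : 'I_3 => nth 0 [:: 1; 'X; 'X%:P] i).

(* The coefficient of x2^j x3^k in p(1, x2, x3). *)
Definition dcoef p (j k : nat) : R := (dehom p)`_j`_k.

Lemma dcoefE p j k :
  dcoef p j k = \sum_(m <- msupp p) p@_m *+ ((m i1 == j) && (m i2 == k)).
Proof.
rewrite /dcoef /dehom /mmap !coef_sum; apply: eq_bigr => m _.
have -> : mmap1 (fun i : 'I_3 => nth 0 [:: 1; 'X; 'X%:P] i) m =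
    'X^(m i1) * ('X^(m i2))%:P :> {poly {poly R}}.
  by rewrite /mmap1 prod_ord3 /= expr1n mul1r rmorphXn.
rewrite mulrA coefMC coefCM coefXn [m i1 == j]eq_sym [m i2 == k]eq_sym.
case: (j == m i1); last by rewrite mulr0 mul0r coef0.
by rewrite mulr1 /= coefCM coefXn mulr_natr.
Qed.

Lemma dcoefM p q j k : dcoef (p * q) j k = conv (dcoef p) (dcoef q) j k.
Proof.
rewrite /dcoef /dehom rmorphM /= /conv coefM -[iota 0 j.+1]/(index_iota 0 j.+1) big_mkord.
rewrite coef_sum; apply: eq_bigr => a _.
by rewrite coefM -[iota 0 k.+1]/(index_iota 0 k.+1) big_mkord.
Qed.

Lemma dcoefD p q j k : dcoef (p + q) j k = dcoef p j k + dcoef q j k.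
Proof. by rewrite /dcoef /dehom rmorphD !coefD. Qed.
Lemma dcoefN p j k : dcoef (- p) j k = - dcoef p j k.
Proof. by rewrite /dcoef /dehom rmorphN !coefN. Qed.
Lemma dcoefZ c p j k : dcoef (c *: p) j k = c * dcoef p j k.
Proof. by rewrite /dcoef /dehom mmapZ /= !coefCM. Qed.

Lemma dcoef0 j k : dcoef 0 j k = 0.
Proof. by rewrite /dcoef /dehom rmorph0 !coef0. Qed.

(** Only powers of x1 survive at the first basis vector; values there thus become initial entries of
    arrays. *)
Lemma meval_dcoef p : p.@[fun i => (i == i0)%:R] = dcoef p 0 0.
Proof.
rewrite mevalE dcoefE; apply: eq_bigr => m _.
rewrite prod_ord3 /= expr1n mul1r !expr0n.
by rewrite -natrM mulnb mulr_natr.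
Qed.

(** In a form of degree d the exponents of x2 and x3 determine that of x1, so at most one monomial
    contributes. *)
Lemma dcoef_homog d p j k : p \is d.-homog ->
  dcoef p j k = if (j + k <= d)%N then p@_(mnm3 (d - j - k) j k) else 0.
Proof.
move=> hp; rewrite dcoefE; set M := mnm3 _ _ _.
have supp m : m \in msupp p -> ((m i1 == j) && (m i2 == k)) = (j + k <= d)%N && (m == M).
  move=> /(dhomog_mf hp) /=; rewrite mdeg_mnm3 => dm.
  apply/andP/andP => [[/eqP m1 /eqP m2]|[jk /eqP->]].
    by split; [lia|rewrite [m]mnm3E m1 m2 /M (_ : m i0 = d - j - k)%N //; lia].
  by rewrite !mnmE.
case: ifP => jk; last first.
  by rewrite big_seq big1 // => m mp; rewrite supp // jk.
have [Mp|/memN_msupp_eq0 Mp] := boolP (M \in msupp p).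
  rewrite (bigD1_seq M) ?msupp_uniq //= big_seq_cond big1 => [|m /andP[mp mM]].
    by rewrite supp // jk eqxx mulr1n addr0.
  by rewrite supp // jk (negPf mM) mulr0n.
rewrite Mp big_seq big1 // => m mp; rewrite supp // jk /=.
by case: eqP => [->|]; rewrite ?Mp ?mul0rn.
Qed.

Lemma dcoef_homog_inj d p : p \is d.-homog -> (forall j k, dcoef p j k = 0) -> p = 0.
Proof.
move=> hp p0; apply/mpolyP => m; rewrite mcoeff0.
have [dm|dm] := eqVneq (mdeg m) d; last by rewrite (dhomog_nemf_coeff hp).
have := p0 (m i1) (m i2); rewrite (dcoef_homog _ _ hp) -dm mdeg_mnm3 ifT; last by lia.
by rewrite (_ : _ - _ - _ = m i0)%N -?mnm3E //; lia.
Qed.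

Lemma dcoef_mderiv p : p \is 4.-homog ->
  [/\ forall j k, dcoef p^`M(i0) j k = coefd0 (dcoef p) j k,
      forall j k, dcoef p^`M(i1) j k = coefd1 (dcoef p) j k &
      forall j k, dcoef p^`M(i2) j k = coefd2 (dcoef p) j k].
Proof.
move=> hp; have hd i := mderiv_homog i hp.
rewrite /coefd0 /coefd1 /coefd2; split=> j k.
all: rewrite (dcoef_homog _ _ (hd _)) (dcoef_homog _ _ hp) ?mcoeff_mderiv.
(* Above degree 3 both sides vanish: in degree 4 the multiplier of [coefd0] is 0, and beyond that
   the entry is. *)
- have [jk|jk] := leqP (j + k) 3; last first.
    by case: ifP => [jk4|_]; rewrite ?mul0rn // (_ : _ - _ - _ = 0)%N ?mulr0n //; lia.
  rewrite ifT; last by lia.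
  rewrite mnmE /= (_ : 4 - j - k = (3 - j - k).+1)%N; last by lia.
  congr (_@__ *+ _); apply/mnmP; apply: forall_ord3; rewrite mnmDE mnm1E !mnmE /=; lia.
- rewrite addSn ltnS; case: ifP => jk; last by rewrite mul0rn.
  rewrite mnmE /=; congr (_@__ *+ _).
  by apply/mnmP; apply: forall_ord3; rewrite mnmDE mnm1E !mnmE /=; lia.
- rewrite addnS ltnS; case: ifP => jk; last by rewrite mul0rn.
  rewrite mnmE /=; congr (_@__ *+ _).
  by apply/mnmP; apply: forall_ord3; rewrite mnmDE mnm1E !mnmE /=; lia.
Qed.

End Dehomogenization.

Lemma eq_conv (R : comPzRingType) (f f' g g' : nat -> nat -> R) :
  f =2 f' -> g =2 g' -> conv f g =2 conv f' g'.
Proof.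
move=> ff gg j k; rewrite /conv; apply: eq_bigr => a _; apply: eq_bigr => b _.
by rewrite ff gg.
Qed.

Section JacobianCoefficients.
Variables (K : fieldType) (H : polymap 3 K).
Hypothesis hH : forall i, H i 0 \is 4.-homog.

Let h i := dcoef (H i 0).
Let J := jacobian H.
Let D (c : 'I_3) : (nat -> nat -> K) -> nat -> nat -> K :=
  nth (@coefd0 K) [:: @coefd0 K; @coefd1 K; @coefd2 K] c.

Lemma dcoef_high i j k : (4 < j + k)%N -> dcoef (H i 0) j k = 0.
Proof. by move=> jk; rewrite (dcoef_homog _ _ (hH i)) leqNgt jk. Qed.

Lemma dcoef_jacobian r c : dcoef (J r c) =2 D c (h r).
Proof.
have [d0 d1 d2] := dcoef_mderiv (hH r).
by move=> j k; rewrite mxE; elim/forall_ord3: c.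
Qed.

Lemma dcoef_jacobianM r c s d j k :
  dcoef (J r c * J s d) j k = conv (D c (h r)) (D d (h s)) j k.
Proof. by rewrite dcoefM; apply: eq_conv => a b; apply: dcoef_jacobian. Qed.

Lemma dcoef_jacobianM3 r c s d t e j k :
  dcoef (J r c * (J s d * J t e)) j k =
  conv (D c (h r)) (conv (D d (h s)) (D e (h t))) j k.
Proof.
rewrite dcoefM; apply: eq_conv => a b; first exact: dcoef_jacobian.
exact: dcoef_jacobianM.
Qed.

Hypothesis n2 : 2%:R != 0 :> K.
Hypothesis nilJ : nilpotent_mx J.

Lemma jacobian_tr_coef j k : tr_coef (h i0) (h i1) (h i2) j k = 0.
Proof.
have := congr1 (fun p => dcoef p j k) (mxtrace_nilpotent nilJ); rewrite dcoef0 => <-.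
by rewrite /mxtrace sum_ord3 !dcoefD !dcoef_jacobian addrA.
Qed.

Lemma jacobian_minor_coef j k : minor_coef (h i0) (h i1) (h i2) j k = 0.
Proof.
have n2' : 2%:R != 0 :> {mpoly K[3]} by rewrite -mpolyC_nat mpolyC_eq0.
have := congr1 (fun p => dcoef p j k) (minors_nilpotent3 n2' nilJ).
by rewrite dcoef0 !(dcoefD, dcoefN) !dcoef_jacobianM.
Qed.

Lemma jacobian_det_coef j k : det_coef (h i0) (h i1) (h i2) j k = 0.
Proof.
have := congr1 (fun p => dcoef p j k) (det_nilpotent nilJ).
by rewrite dcoef0 det_mx33 !(dcoefD, dcoefN) !dcoef_jacobianM3.
Qed.

Lemma jacobian_action_coef r j k :
  \sum_(c < 3) J r c * H c 0 = 0 -> coef_action (h i0) (h i1) (h i2) (h r) j k = 0.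
Proof.
move=> /(congr1 (fun p => dcoef p j k)); rewrite dcoef0 sum_ord3 !dcoefD addrA => <-.
rewrite /coef_action; congr (_ + _ + _); rewrite dcoefM;
  by apply: eq_conv => // a b; rewrite dcoef_jacobian.
Qed.

(** The premise is equality of the logarithmic derivatives of two components, with denominators
    cleared. *)
Lemma jacobian_dlog_coef r s c j k : H r 0 * J s c = H s 0 * J r c ->
  conv (h r) (D c (h s)) j k = conv (h s) (D c (h r)) j k.
Proof.
move=> /(congr1 (fun p => dcoef p j k)); rewrite !dcoefM => e.
have convJ q t : conv (h q) (dcoef (J t c)) j k = conv (h q) (D c (h t)) j k.
  by apply: eq_conv => [a b|]; [reflexivity|apply: dcoef_jacobian].
exact: etrans (esym (convJ r s)) (etrans e (convJ s r)).
Qed.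

End JacobianCoefficients.

(** * Triangular form at a generic point *)

Lemma unitmx_ker0 (F : fieldType) n (T : 'M[F]_n) :
  (forall x : 'cV_n, T *m x = 0 -> x = 0) -> T \in unitmx.
Proof.
move=> inj; rewrite -unitmx_tr -row_free_unit -kermx_eq0; apply/eqP/row_matrixP => i.
apply: trmx_inj; rewrite row0 trmx0; apply: inj.
by rewrite -{1}[T]trmxK -trmx_mul -row_mul mulmx_ker row0 trmx0.
Qed.

Definition colmx3 (R : nzRingType) (a b c : 'cV[R]_3) : 'M[R]_3 :=
  \matrix_(i, j) (nth 0 [:: a; b; c] j) i 0.

Lemma colmx3_mul (R : comNzRingType) (a b c x : 'cV[R]_3) :
  colmx3 a b c *m x = x i0 0 *: a + x i1 0 *: b + x i2 0 *: c.
Proof.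
apply/colP => i; rewrite !mxE sum_ord3 !mxE /= addrA.
by rewrite ![_ * x _ _]mulrC.
Qed.

Lemma mul_colmx3 (R : comNzRingType) (A : 'M[R]_3) (a b c : 'cV[R]_3) :
  A *m colmx3 a b c = colmx3 (A *m a) (A *m b) (A *m c).
Proof.
apply/matrixP => i; apply: forall_ord3; rewrite !mxE;
  by apply: eq_bigr => k _; rewrite mxE.
Qed.

Lemma colmx3_unit (F : fieldType) (a b c : 'cV[F]_3) :
  (forall x y z : F, x *: a + y *: b + z *: c = 0 -> [/\ x = 0, y = 0 & z = 0]) ->
  colmx3 a b c \in unitmx.
Proof.
move=> free; apply: unitmx_ker0 => x; rewrite colmx3_mul => /free[x0 x1 x2].
by apply/colP; apply: forall_ord3; rewrite !mxE.
Qed.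

Section PointValues.
Variables (F : fieldType) (H : polymap 3 F) (a : 'cV[F]_3).
Implicit Types (T B : 'M[F]_3) (w : 'cV[F]_3).

Definition eval_mx m n (M : 'M[{mpoly F[3]}]_(m, n)) : 'M[F]_(m, n) :=
  map_mx (meval (fun i => a i 0)) M.

Local Notation v := (eval_mx H).
Local Notation A := (eval_mx (jacobian H)).

Lemma jacobian_euler : (forall i, H i 0 \is 4.-homog) -> A *m a = 4%:R *: v.
Proof.
move=> hH; apply/colP => i; rewrite !mxE.
have := congr1 (meval (fun i => a i 0)) (euler_homog (hH i)).
rewrite raddf_sum raddfMn /= mulr_natl => <-; apply: eq_bigr => k _.
by rewrite !mxE /= mevalM mevalXU mulrC.
Qed.

Lemma jacobian_cube : nilpotent_mx (jacobian H) -> A *m A *m A = 0.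
Proof.
move=> nJ; rewrite /eval_mx -!map_mxM.
have := nilpotent_expn nJ; rewrite !exprS expr0 mulr1 -!mulmxE mulmxA => ->.
by rewrite map_mx0.
Qed.

(** Since T maps the first basis vector to a, the conjugate map has value T^-1 v = w and Jacobian
    matrix T^-1 A T = B at that vector. The last two columns of B are the entries of order one. *)
Lemma point_linear_conj T w B : (forall i, H i 0 \is 4.-homog) ->
  T \in unitmx -> col i0 T = a -> T *m w = v -> T *m B = A *m T ->
  forall i, let h := dcoef (linear_conj T H i 0) in
  [/\ h 0%N 0%N = w i 0, h 1%N 0%N = B i i1 & h 0%N 1%N = B i i2].
Proof.
move=> hH uT Ta Tw TB i /=.
have e : (fun j => \sum_(l < 3) T j l * (l == i0)%:R) =1 (fun j => a j 0).
  by move=> j; rewrite sum_ord3 /= mulr1 !mulr0 !addr0 -Ta mxE.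
have wE : w = invmx T *m v by rewrite -Tw mulmxA mulVmx // mul1mx.
have BE : B = invmx T *m A *m T by rewrite -mulmxA -TB mulmxA mulVmx // mul1mx.
have evJ k : dcoef (jacobian (linear_conj T H) i k) 0 0 = B i k.
  rewrite -meval_dcoef jacobian_linear_conj BE -!mulmxA !mxE raddf_sum.
  apply: eq_bigr => l _; rewrite /= !mxE mevalM mevalC; congr (_ * _).
  rewrite raddf_sum; apply: eq_bigr => s _; rewrite /= mevalM !mxE mevalC.
  congr (_ * _); rewrite comp_mpoly_meval; apply: meval_eq => j.
  rewrite -e tnth_mktuple raddf_sum; apply: eq_bigr => t _.
  by rewrite /= mevalZ mevalXU.
have [_ d1 d2] := dcoef_mderiv (homog_linear_conj T hH i).
split; [|by rewrite -evJ [jacobian _ _ _]mxE d1|by rewrite -evJ [jacobian _ _ _]mxE d2].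
rewrite -meval_dcoef meval_linear_conj wE mxE; apply: eq_bigr => k _.
by rewrite mxE (meval_eq _ e).
Qed.

End PointValues.

Lemma jacobian_mul_linear_conj (F : fieldType) n (T : 'M[F]_n) (H : polymap n F) :
  T \in unitmx -> jacobian H *m H = 0 ->
  jacobian (linear_conj T H) *m linear_conj T H = 0.
Proof.
move=> uT JH; rewrite jacobian_linear_conj -mulmxA -subst_linear_conj // -mulmxA.
have -> : subst_linear T H = map_mx (comp_mpoly (linear_forms T)) H.
  by apply/colP => i; rewrite !mxE.
by rewrite -map_mxM JH map_mx0 mulmx0.
Qed.

(** The hypothesis is a symmetry in i and j of a bilinear expression; it survives substitution,
    multiplication by T on the right, and the same change [invmx T] in both indices. *)
Lemma dlog_linear_conj (F : fieldType) n (T : 'M[F]_n) (H : polymap n F) :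
  (forall i j k, H i 0 * jacobian H j k = H j 0 * jacobian H i k) ->
  let H' := linear_conj T H in
  forall i j k, H' i 0 * jacobian H' j k = H' j 0 * jacobian H' i k.
Proof.
move=> JH H' i j k; rewrite /H' jacobian_linear_conj -mulmxA.
set G := map_mx _ (jacobian H) *m _.
have HG p q : (H p 0 \mPo linear_forms T) * G q k = (H q 0 \mPo linear_forms T) * G p k.
  rewrite !mxE !mulr_sumr; apply: eq_bigr => l _.
  by rewrite !mulrA; congr (_ * _); rewrite ![map_mx _ _ _ _]mxE -!rmorphM /= JH.
rewrite !linear_conjE ![(_ *m G) _ _]mxE !big_distrlr /= [RHS]exchange_big /=.
apply: eq_bigr => p _; apply: eq_bigr => q _; rewrite ![map_mx (@mpolyC n F) _ _ _]mxE.
by rewrite mulrACA HG [RHS]mulrACA [X in X * _]mulrC.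
Qed.

Lemma dcoefX (R : comNzRingType) (m : 'X_{1..3}) j k :
  dcoef ('X_[m] : {mpoly R[3]}) j k = ((m i1 == j) && (m i2 == k))%:R.
Proof. by rewrite dcoefE msuppX big_seq1 mcoeffX eqxx. Qed.

Section Triangular.
Variables (F : fieldType) (H : polymap 3 F) (a : 'cV[F]_3).
Hypotheses (n2 : 2%:R != 0 :> F) (n3 : 3%:R != 0 :> F).
Hypothesis hH : forall i, H i 0 \is 4.-homog.
Hypothesis nJ : nilpotent_mx (jacobian H).

Let v := eval_mx a H.
Let A := eval_mx a (jacobian H).

(* These hold when a is generic: the conclusions of Av0 and dlog0 state the
   vanishing of polynomials whose values at a vanish by their premises. *)
Hypothesis v0 : v != 0.
Hypothesis Av0 : A *m v = 0 -> jacobian H *m H = 0.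
Hypothesis dlog0 : (forall i j k, v i 0 * A j k = v j 0 * A i k) ->
  forall i j k, H i 0 * jacobian H j k = H j 0 * jacobian H i k.

Let Aa : A *m a = 4%:R *: v. Proof. exact: jacobian_euler. Qed.
Let AAA : A *m A *m A = 0. Proof. exact: jacobian_cube. Qed.
Let n4 : 4%:R != 0 :> F. Proof. by rewrite (natrM _ 2 2) mulf_neq0. Qed.

(** From 4 v = A a follows 4 A^2 v = A^3 a = 0. *)
Let AAv : A *m (A *m v) = 0.
Proof.
apply: (scalerI n4); rewrite scaler0 !scalemxAr -Aa.
by rewrite !mulmxA AAA mul0mx.
Qed.

Let scale_eq0 (x : F) (u : 'cV[F]_3) : u != 0 -> x *: u = 0 -> x = 0.
Proof. by move=> u0 /eqP; rewrite scaler_eq0 (negPf u0) orbF => /eqP. Qed.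

(** A maps a to 4 v, v to A v and A v to 0, so its matrix in the basis a, v, A v supplies the
    initial values of [cyclic_coefs]. *)
Lemma triangular_cyclic : A *m v != 0 -> exists2 T : 'M[F]_3, T \in unitmx &
  linear_conj T H i0 0 = 0 /\ linear_conj T H i1 0 = 'X_i0 ^+ 4.
Proof.
move=> Av; pose T := colmx3 a v (A *m v).
have uT : T \in unitmx.
  (* Applying A^2 to the relation isolates x, then applying A isolates y. *)
  apply: colmx3_unit => x y z e.
  have x0 : x = 0.
    apply: (scale_eq0 Av); apply: (scalerI n4).
    have := congr1 (mulmx (A *m A)) e; rewrite mulmx0 !mulmxDr -!scalemxAr -!mulmxA.
    by rewrite Aa -!scalemxAr AAv mulmx0 !scaler0 !addr0 scalerA mulrC -scalerA.
  move: e; rewrite x0 scale0r add0r => e.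
  have y0 : y = 0.
    apply: (scale_eq0 Av); have := congr1 (mulmx A) e.
    by rewrite mulmx0 mulmxDr -!scalemxAr AAv scaler0 addr0.
  by split=> //; apply: (scale_eq0 Av); move: e; rewrite y0 scale0r add0r.
have nH := nilpotent_linear_conj uT nJ; have hT := homog_linear_conj T hH.
pose w : 'cV[F]_3 := \col_i (i == i1)%:R.
pose B := colmx3 (4%:R *: w) (\col_i (i == i2)%:R) 0.
have Ta : col i0 T = a by apply/colP => i; rewrite !mxE.
have Tw : T *m w = v by rewrite colmx3_mul !mxE /= !scale0r scale1r add0r addr0.
have TB : T *m B = A *m T.
  rewrite !mul_colmx3 Aa AAv mulmx0 -scalemxAr Tw.
  by rewrite colmx3_mul !mxE /= !scale0r scale1r !add0r.
have pt := point_linear_conj hH uT Ta Tw TB.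
exists T => //; move: (linear_conj T H) pt nH hT => H' pt nH hT.
move: (pt i0) (pt i1) (pt i2); rewrite !mxE /=.
move=> -[h100 h110 h101] [h200 h210 h201] [h300 h310 h301].
have [h1_0 h2_0] := cyclic_coefs n2 n3 (dcoef_high hT i0) (dcoef_high hT i1)
  (dcoef_high hT i2) h100 h110 h101 h200 h210 h201 h300 h310 h301
  (jacobian_tr_coef hT nH) (jacobian_minor_coef hT n2 nH) (jacobian_det_coef hT nH).
split; first exact: dcoef_homog_inj (hT i0) h1_0.
have hX : ('X_i0 ^+ 4 : {mpoly F[3]}) \is 4.-homog.
  by rewrite mpolyXn dhomogX /= mdegMn mdeg1.
apply/eqP; rewrite -subr_eq0; apply/eqP; apply: (@dcoef_homog_inj _ 4).
  by apply: rpredB; [exact: hT|exact: hX].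
move=> j k; rewrite dcoefD dcoefN mpolyXn dcoefX !mulmnE !mnm1E /=.
case: (posnP (j + k)) => [/eqP|jk]; last first.
  by rewrite h2_0 //; case: j k jk => [|j] [|k] //; rewrite subr0.
by rewrite addn_eq0 => /andP[/eqP-> /eqP->]; rewrite h200 subrr.
Qed.

(** Otherwise w, a, 4 v is a Jordan chain of A. By [Av0] the product JH H vanishes identically, so
    [quasi_translation_coefs] applies in the basis a, v, w. *)
Lemma no_rank2_quasi_translation : A *m v = 0 -> forall w, A *m w <> a.
Proof.
move=> Av w Aw; pose T := colmx3 a v w.
have uT : T \in unitmx.
  apply: colmx3_unit => x y z e.
  have z0 : z = 0.
    apply: (scale_eq0 v0); apply: (scalerI n4).
    have := congr1 (mulmx (A *m A)) e; rewrite mulmx0 !mulmxDr -!scalemxAr -!mulmxA.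
    rewrite Aw Aa -!scalemxAr Av mulmx0 !scaler0 !add0r.
    by rewrite scalerA mulrC -scalerA.
  move: e; rewrite z0 scale0r addr0 => e.
  have x0 : x = 0.
    apply: (scale_eq0 v0); apply: (scalerI n4); have := congr1 (mulmx A) e.
    by rewrite mulmx0 mulmxDr -!scalemxAr Av Aa !scaler0 addr0 scalerA mulrC -scalerA.
  by split=> //; apply: (scale_eq0 v0); move: e; rewrite x0 scale0r add0r.
have nH := nilpotent_linear_conj uT nJ; have hT := homog_linear_conj T hH.
pose w1 : 'cV[F]_3 := \col_i (i == i1)%:R.
pose B := colmx3 (4%:R *: w1) 0 (\col_i (i == i0)%:R).
have Ta : col i0 T = a by apply/colP => i; rewrite !mxE.
have Tw : T *m w1 = v by rewrite colmx3_mul !mxE /= !scale0r scale1r add0r addr0.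
have TB : T *m B = A *m T.
  rewrite !mul_colmx3 Aa Av Aw mulmx0 -scalemxAr Tw.
  by rewrite colmx3_mul !mxE /= !scale0r scale1r !addr0.
have pt := point_linear_conj hH uT Ta Tw TB.
have act i j k : coef_action (dcoef (linear_conj T H i0 0))
    (dcoef (linear_conj T H i1 0)) (dcoef (linear_conj T H i2 0))
    (dcoef (linear_conj T H i 0)) j k = 0.
  apply: jacobian_action_coef => //.
  by have /colP/(_ i) := jacobian_mul_linear_conj uT (Av0 Av); rewrite [LHS]mxE [RHS]mxE.
move: (linear_conj T H) pt nH hT act => H' pt nH hT act.
move: (pt i0) (pt i1) (pt i2); rewrite !mxE /=.
move=> -[h100 h110 h101] [h200 h210 h201] [h300 h310 h301].
exact: quasi_translation_coefs n2 n3 (dcoef_high hT i0) (dcoef_high hT i1)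
  (dcoef_high hT i2) h100 h110 h101 h200 h210 h201 h300 h310 h301
  (jacobian_tr_coef hT nH) (act i0) (act i1) (act i2).
Qed.
(** The determinants with a standard vector in the middle are, up to sign, the 2-minors of (a, v).
    If all vanish, then v_k a = a_k v with some v_k nonzero, and applying A gives 4 v_k v = 0. *)
Let transversal : A *m v = 0 -> exists e, colmx3 a e v \in unitmx.
Proof.
move=> Av; pose d k : 'cV[F]_3 := \col_i (i == k)%:R.
have [u|] := boolP [exists k, colmx3 a (d k) v \in unitmx].
  by case/existsP: u => k; exists (d k).
move/existsPn => sing.
have cross i j : a i 0 * v j 0 = a j 0 * v i 0.
  have det0 k : \det (colmx3 a (d k) v) = 0.
    by have := sing k; rewrite unitmxE unitfE negbK => /eqP.
  have e0 := det0 i0; have e1 := det0 i1; have e2 := det0 i2.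
  move: e0 e1 e2; rewrite !det_mx33 !mxE /= => e0 e1 e2.
  apply/eqP; rewrite -subr_eq0; apply/eqP.
  elim/forall_ord3: i; elim/forall_ord3: j; rewrite ?subrr //.
  - by rewrite -[RHS]oppr0 -e2; ring.
  - by rewrite -[RHS]e1; ring.
  - by rewrite -[RHS]e2; ring.
  - by rewrite -[RHS]oppr0 -e0; ring.
  - by rewrite -[RHS]oppr0 -e1; ring.
  - by rewrite -[RHS]e0; ring.
have [k vk] : exists k, v k 0 != 0.
  apply/existsP; apply: contraNT v0 => /existsPn vz.
  by apply/eqP/colP => k; rewrite [RHS]mxE; apply/eqP/negbNE/vz.
have e : v k 0 *: a = a k 0 *: v.
  by apply/colP => i; rewrite [LHS]mxE [RHS]mxE mulrC cross.
have := congr1 (mulmx A) e; rewrite -!scalemxAr Aa Av scaler0 scalerA.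
by move/(scale_eq0 v0)/eqP; rewrite mulf_eq0 (negPf vk) (negPf n4).
Qed.

Lemma triangular_rank1 : A *m v = 0 -> exists2 T : 'M[F]_3, T \in unitmx &
  linear_conj T H i0 0 = 0 /\ linear_conj T H i1 0 = 0.
Proof.
move=> Av; have [e uT] := transversal Av; set T := colmx3 a e v in uT.
have hT := homog_linear_conj T hH.
pose w : 'cV[F]_3 := \col_i (i == i2)%:R.
have Ta : col i0 T = a by apply/colP => i; rewrite !mxE.
have Tw : T *m w = v by rewrite colmx3_mul !mxE /= !scale0r scale1r !add0r.
pose c := invmx T *m A *m e; pose B := colmx3 (4%:R *: w) c 0.
have Te : T *m c = A *m e by rewrite /c !mulmxA mulmxV // mul1mx.
have TB : T *m B = A *m T.
  by rewrite !mul_colmx3 Aa Av mulmx0 -scalemxAr Tw Te.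
(* The diagonal of [B] is 0, c1, 0, so c1 is the trace of B, which equals that of A. *)
have c1 : c i1 0 = 0.
  have trA : \tr A = 0.
    by rewrite /A /eval_mx trace_map_mx mxtrace_nilpotent // rmorph0.
  have : \tr B = 0.
    have -> : B = invmx T *m (A *m T) by rewrite -TB mulmxA mulVmx // mul1mx.
    by rewrite mxtrace_mulC -mulmxA mulmxV // mulmx1.
  by rewrite /mxtrace sum_ord3 !mxE /= mulr0 addr0 add0r.
have c0 : c i0 0 = 0.
  (* Now A e = c0 a + c2 v and A a = 4 v, so A maps e - (c2 / 4) a to c0 a; dividing by c0 gives a
     preimage of a. *)
  apply/eqP/negP => /negP c0.
  have := no_rank2_quasi_translation Av
    (w := (c i0 0)^-1 *: (e - (c i2 0 / 4%:R) *: a)).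
  apply; rewrite -scalemxAr mulmxBr -Te colmx3_mul c1 -scalemxAr Aa.
  by rewrite scale0r addr0 scalerA divfK // addrK scalerA mulVf // scale1r.
(* A maps a, e, v to 4 v, c2 v, 0; hence r T has these three multipliers as entries. *)
have [r AE] : exists r : 'rV_3, A = v *m r.
  exists (\row_j [:: 4%:R; c i2 0; 0]`_j *m invmx T).
  rewrite mulmxA; apply: (canRL (mulmxK uT)); rewrite -TB mul_colmx3 mulmx0.
  rewrite -scalemxAr Tw colmx3_mul c0 c1 !scale0r !add0r.
  apply/matrixP => i; apply: forall_ord3;
    by rewrite !mxE big_ord1 !mxE /= ?mulr0 // mulrC.
have AE' j k : A j k = v j 0 * r 0 k by rewrite AE [LHS]mxE big_ord1.
have vA i j k : v i 0 * A j k = v j 0 * A i k by rewrite !AE' mulrCA.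
have dlog := dlog_linear_conj T (dlog0 vA).
have pt := point_linear_conj hH uT Ta Tw TB.
exists T => //; move: (linear_conj T H) pt hT dlog => H' pt hT /= dlog.
have [g0 _ _] := pt i2.
(* At the first basis vector this component is 0 while the last one is 1, so their common
   logarithmic derivative forces it to vanish. *)
have eq0 i : w i 0 = 0 -> H' i 0 = 0.
  move=> wi; have [f0 _ _] := pt i.
  apply: dcoef_homog_inj (hT i) _.
  apply: (eq0_of_dlog_coef n2 n3 (dcoef_high hT i) _ (g := dcoef (H' i2 0))).
  - by rewrite f0.
  - by rewrite g0 mxE.
  - by move=> j k; apply: (jacobian_dlog_coef hT (c := i1)).
  - by move=> j k; apply: (jacobian_dlog_coef hT (c := i2)).
by split; apply: eq0; rewrite mxE.
Qed.

Lemma triangular_of_point : exists (T : 'M[F]_3) (c : F), [/\ T \in unitmx,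
  linear_conj T H i0 0 = 0 & linear_conj T H i1 0 = c *: 'X_i0 ^+ 4].
Proof.
have [Av|Av] := eqVneq (A *m v) 0.
  have [T uT [T0 T1]] := triangular_rank1 Av.
  by exists T, 0; rewrite scale0r.
have [T uT [T0 T1]] := triangular_cyclic Av.
by exists T, 1; rewrite scale1r.
Qed.

End Triangular.

(** * Descent to the base field *)

Lemma row_free_col_mx (F : fieldType) m n (M : 'M[F]_(m, n)) (u : 'rV_n) :
  row_free M -> ~~ (u <= M)%MS -> row_free (col_mx M u).
Proof.
move=> /eqP rM uM; rewrite -row_leq_rank.
have : (\rank M < \rank (col_mx M u))%N.
  apply: rank_ltmx; rewrite ltmxE -addsmxE addsmxSl.
  by apply: contra uM; apply: submx_trans; rewrite -addsmxE addsmxSr.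
by rewrite rM; apply: leq_trans; rewrite addn1.
Qed.

Lemma linear_conj_combination (F : fieldType) n (T : 'M[F]_n) (H : polymap n F) i :
  linear_conj T H i 0 = (\sum_(k < n) invmx T i k *: H k 0) \mPo linear_forms T.
Proof.
rewrite linear_conjE raddf_sum; apply: eq_bigr => k _.
by rewrite /= comp_mpolyZ mul_mpolyC.
Qed.

Lemma combination_linear_conj (F : fieldType) n (T : 'M[F]_n) (H : polymap n F) i :
  T \in unitmx ->
  \sum_(k < n) invmx T i k *: H k 0 = linear_conj T H i 0 \mPo linear_forms (invmx T).
Proof.
move=> uT; rewrite linear_conj_combination comp_linear_forms mulmxV //.
by rewrite linear_forms1 comp_mpoly_id.
Qed.

Section FieldExtension.
Variables (K L : fieldType) (f : {rmorphism K -> L}) (n : nat).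
Implicit Types p : {mpoly K[n]}.

Lemma mderiv_map_mpoly p i : (map_mpoly f p)^`M(i) = map_mpoly f p^`M(i).
Proof.
apply/mpolyP => m; rewrite mcoeff_mderiv !mcoeff_map_mpoly mcoeff_mderiv.
by rewrite [RHS]raddfMn.
Qed.

Lemma map_mpoly_homog p d : p \is d.-homog -> map_mpoly f p \is d.-homog.
Proof.
move=> /dhomogP hp; apply/dhomogP => m.
rewrite mcoeff_msupp mcoeff_map_mpoly fmorph_eq0 => nz.
by apply: hp; rewrite mcoeff_msupp.
Qed.

Lemma jacobian_map_mpoly (H : polymap n K) :
  jacobian (map_mx (map_mpoly f) H : polymap n L) = map_mx (map_mpoly f) (jacobian H).
Proof. by apply/matrixP => i j; rewrite !mxE mderiv_map_mpoly. Qed.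

(* The relations are the row kernel of the matrix of coefficients, whose rank
   does not depend on the field. *)
Lemma relations_descend m r (p : 'I_m -> {mpoly K[n]}) (B : 'M[L]_(r, m)) :
  row_free B -> (forall i, \sum_(k < m) B i k *: map_mpoly f (p k) = 0) ->
  exists2 C : 'M[K]_(r, m), row_free C &
    forall i, \sum_(k < m) C i k *: p k = 0.
Proof.
move=> freeB relB.
(* All monomials of the [p k] have degree below d, so finitely many columns hold every
   coefficient. *)
pose d := \max_(k < m) msize (p k).
pose A := \matrix_(k < m, s < #|{: 'X_{1..n < d}}|) (p k)@_(enum_val s).
have AE r' (C : 'M[K]_(r', m)) :
    C *m A = 0 -> forall i, \sum_(k < m) C i k *: p k = 0.
  move=> CA i; apply/mpolyP => mu; rewrite mcoeff0 raddf_sum /=.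
  have [lt_mu|le_mu] := ltnP (mdeg mu) d.
    have := congr1 (fun M : 'M_(_, _) => M i (enum_rank (BMultinom lt_mu))) CA.
    rewrite !mxE => {2}<-; apply: eq_bigr => k _.
    by rewrite mxE enum_rankK mcoeffZ.
  rewrite big1 // => k _; rewrite mcoeffZ [_@_mu]memN_msupp_eq0 ?mulr0 //.
  apply: contraL le_mu => /msize_mdeg_lt; rewrite -ltnNge => /leq_trans; apply.
  by rewrite /d (bigD1 k) //= leq_maxl.
have BA : B *m map_mx f A = 0.
  apply/matrixP => i s; rewrite !mxE.
  have := congr1 (mcoeff (enum_val s)) (relB i); rewrite mcoeff0 raddf_sum /= => {2}<-.
  by apply: eq_bigr => k _; rewrite mcoeffZ mcoeff_map_mpoly !mxE.
have rk : (r <= \rank (kermx A))%N.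
  by rewrite -(mxrank_map f) map_kermx -(eqP freeB) mxrankS //; apply/sub_kermxP.
(* [pid_mx r] keeps the first r vectors of a basis of the kernel. *)
exists ((pid_mx r : 'M_(r, _)) *m row_base (kermx A)).
  by rewrite /row_free mxrankMfree ?row_base_free // rank_pid_mx.
apply: AE; apply/sub_kermxP; apply: submx_trans (submxMl _ _) _.
by rewrite eq_row_base.
Qed.

End FieldExtension.

(** * The generic point *)

Section GenericPoint.
Variables (K L : fieldType) (n : nat) (tau : {rmorphism {mpoly K[n]} -> L}).

Definition constants : {rmorphism K -> L} := tau \o @mpolyC n K.

Definition generic_point : 'cV[L]_n := \col_i tau 'X_i.

(** The coordinates of the point are the images of the variables, so evaluation there is [tau]
    itself. *)
Lemma meval_generic_point (p : {mpoly K[n]}) :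
  (map_mpoly constants p).@[fun i => generic_point i 0] = tau p.
Proof.
elim/mpoly_ring_ind: p => [c|i|p q IHp IHq|p q IHp IHq].
- by rewrite map_mpolyC mevalC.
- by rewrite map_mpolyX mevalXU mxE.
- by rewrite rmorphD mevalD IHp IHq rmorphD.
- by rewrite rmorphM mevalM IHp IHq rmorphM.
Qed.

End GenericPoint.

(** Injectivity of [tau] turns vanishing at the generic point into vanishing of polynomials, which
    yields the genericity hypotheses of [triangular_of_point]. *)
Lemma triangular_generic (K L : fieldType) (tau : {rmorphism {mpoly K[3]} -> L})
    (H : polymap 3 K) (n2 : 2%:R != 0 :> K) (n3 : 3%:R != 0 :> K) :
  injective tau ->
  (forall i, H i 0 \is 4.-homog) -> H != 0 -> nilpotent_mx (jacobian H) ->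
  let HL : polymap 3 L := map_mx (map_mpoly (constants tau)) H in
  exists (T : 'M_3) c, [/\ T \in unitmx,
    linear_conj T HL i0 0 = 0 & linear_conj T HL i1 0 = c *: 'X_i0 ^+ 4].
Proof.
move=> inj hH H0 nJ HL.
have evE m k (M : 'M[{mpoly K[3]}]_(m, k)) :
    eval_mx (generic_point tau) (map_mx (map_mpoly (constants tau)) M) = map_mx tau M.
  by apply/matrixP => i j; rewrite !mxE meval_generic_point.
have JE : jacobian HL = map_mx (map_mpoly (constants tau)) (jacobian H).
  exact: jacobian_map_mpoly.
have nL k : k%:R != 0 :> K -> k%:R != 0 :> L.
  by rewrite -(rmorph_nat (constants tau)) fmorph_eq0.
have inj_mx m k (M N : 'M_(m, k)) : map_mx tau M = map_mx tau N -> M = N.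
  move=> e; apply/matrixP => i j; apply: inj.
  by have /matrixP/(_ i j) := e; rewrite !mxE.
apply: (triangular_of_point (a := generic_point tau)) => //; try exact: nL.
- by move=> i; rewrite mxE map_mpoly_homog.
- have [k Hk] := nJ; exists k; rewrite JE.
  have -> : map_mx (map_mpoly (constants tau)) (jacobian H) ^+ k =
     map_mx (map_mpoly (constants tau)) (jacobian H ^+ k).
    elim: (k) => [|m IH]; first by rewrite !expr0 map_mx1.
    by rewrite !exprS IH -!mulmxE map_mxM.
  by rewrite Hk map_mx0.
- by rewrite evE; apply: contraNneq H0 => e; apply/eqP/inj_mx; rewrite e map_mx0.
- rewrite JE !evE -map_mxM -map_mxM => e.
  rewrite (_ : jacobian H *m H = 0) ?map_mx0 //.
  by apply: inj_mx; rewrite e map_mx0.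
rewrite JE !evE => e i j k; rewrite ![map_mx _ _ _ _]mxE -!rmorphM; congr (map_mpoly _ _).
by apply: inj; have := e i j k; rewrite ![map_mx _ _ _ _]mxE -!rmorphM.
Qed.

Definition linear_form (R : nzRingType) n (l : 'rV[R]_n) : {mpoly R[n]} :=
  \sum_(k < n) l 0 k *: 'X_k.

Lemma linear_form_eq0 (R : nzRingType) n (l : 'rV[R]_n) : linear_form l = 0 -> l = 0.
Proof.
move=> e; apply/rowP => k; have := congr1 (mcoeff U_(k)) e.
rewrite raddf_sum mcoeff0 (bigD1 k) //= big1 ?addr0 => [|j jk].
  by rewrite mcoeffZ mcoeffXU eqxx mulr1 mxE.
by rewrite mcoeffZ mcoeffXU (negPf jk) mulr0.
Qed.

Lemma linear_form_row (K : fieldType) n (U : 'M[K]_n) i :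
  linear_form (row i U) = 'X_i \mPo linear_forms U.
Proof.
rewrite comp_mpolyXU -tnth_nth tnth_mktuple.
by apply: eq_bigr => k _; rewrite mxE.
Qed.

(** The relations given by l and by (u, s) are independent relations over L among the [p k] and q,
    so two independent ones exist over K, and these cannot both come from l. *)
Lemma relation_extend (K L : fieldType) (f : {rmorphism K -> L}) n
    (p : 'I_n -> {mpoly K[n]}) (q : {mpoly K[n]}) (l : 'rV[K]_n) (u : 'rV[L]_n) (s : L) :
  q != 0 -> l != 0 -> \sum_(k < n) l 0 k *: p k = 0 ->
  ~~ (u <= map_mx f l)%MS ->
  \sum_(k < n) u 0 k *: map_mpoly f (p k) + s *: map_mpoly f q = 0 ->
  exists (m : 'rV[K]_n) t, ~~ (m <= l)%MS /\ \sum_(k < n) m 0 k *: p k = t *: q.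
Proof.
move=> q0 l0 rell ul relu.
pose p' (k : 'I_(n + 1)) := match split k with inl k => p k | inr _ => q end.
have sumE (R : nzRingType) (g : 'I_(n + 1) -> {mpoly R[n]}) (x : 'rV[R]_n) (y : 'M_1) :
    \sum_k row_mx x y 0 k *: g k =
    \sum_k x 0 k *: g (lshift 1 k) + y 0 0 *: g (rshift n 0).
  rewrite big_split_ord big_ord1 row_mxEr; congr (_ + _).
  by apply: eq_bigr => k _; rewrite row_mxEl.
have pl k : p' (lshift 1 k) = p k by rewrite /p' (unsplitK (inl k)).
have pr : p' (rshift n 0) = q by rewrite /p' (unsplitK (inr 0)).
pose B := col_mx (row_mx (map_mx f l) 0) (row_mx u s%:M).
have freel : row_free (row_mx (map_mx f l) (0 : 'M_1)).
  rewrite -row_leq_rank lt0n mxrank_eq0; apply: contraNneq l0.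
  by rewrite -row_mx0 => /eq_row_mx[/eqP]; rewrite map_mx_eq0.
have freeB : row_free B.
  apply: row_free_col_mx => //; apply: contra ul => /sub_rVP[x].
  by rewrite scale_row_mx => /eq_row_mx[-> _]; rewrite scalemx_sub.
have relB i : \sum_k B i k *: map_mpoly f (p' k) = 0.
  rewrite -[i]splitK; case: (split i) => j; rewrite ord1 /= /B.
    under eq_bigr => k _ do rewrite col_mxEu.
    rewrite sumE mxE scale0r addr0.
    rewrite -[RHS](rmorph0 (map_mpoly f)) -rell rmorph_sum /=.
    by apply: eq_bigr => k _; rewrite map_mpolyZ mxE pl.
  under eq_bigr => k _ do rewrite col_mxEd.
  rewrite sumE pr; under eq_bigr => k _ do rewrite pl.
  have -> : (s%:M : 'M_1) 0 0 = s by rewrite mxE eqxx mulr1n.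
  exact: relu.
have [C freeC relC] := relations_descend freeB relB.
have relC' i : \sum_k lsubmx C i k *: p k + rsubmx C i 0 *: q = 0.
  have := relC i; rewrite -{1}[C]hsubmxK.
  rewrite big_split_ord big_ord1 row_mxEr pr /= => e; rewrite -[RHS]e; congr (_ + _).
  by apply: eq_bigr => k _; rewrite row_mxEl pl.
(* If the left part of every row of C were a multiple of l, then [rell] and [q0] would make the last
   column of C zero, and C would have rank at most 1 instead of 2. *)
have [i Ci] : exists i, ~~ (row i (lsubmx C) <= l)%MS.
  apply/row_subPn; apply/negP => Cl.
  have : (C <= row_mx l (0 : 'M_1))%MS.
    apply/row_subP => i; have /sub_rVP[x xl] := submx_trans (row_sub i _) Cl.
    apply/sub_rVP; exists x; rewrite scale_row_mx scaler0 -[C]hsubmxK row_row_mx xl.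
    congr row_mx; apply/rowP => j; rewrite ord1 !mxE.
    have /eqP := relC' i; rewrite (_ : \sum_k _ = 0) ?add0r.
      by rewrite scaler_eq0 (negPf q0) orbF mxE => /eqP.
    have /rowP xlE := xl.
    rewrite -[RHS](scaler0 _ x) -[in RHS]rell scaler_sumr; apply: eq_bigr => k _.
    by have := xlE k; rewrite [LHS]mxE => ->; rewrite mxE scalerA.
  move/mxrankS; rewrite (eqP freeC) => /leq_trans/(_ (rank_leq_row _)).
  by rewrite addn1 ltnn.
exists (row i (lsubmx C)), (- rsubmx C i 0); split=> //.
apply/eqP; rewrite scaleNr -addr_eq0; apply/eqP; rewrite -[RHS](relC' i).
by congr (_ + _); apply: eq_bigr => k _; rewrite mxE.
Qed.

Lemma triangular_descend (K L : fieldType) (f : {rmorphism K -> L}) (H : polymap 3 K)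
    (HL := map_mx (map_mpoly f) H : polymap 3 L) (T : 'M[L]_3) c :
  T \in unitmx -> linear_conj T HL i0 0 = 0 -> linear_conj T HL i1 0 = c *: 'X_i0 ^+ 4 ->
  exists (S : 'M[K]_3) d, [/\ S \in unitmx,
    linear_conj S H i0 0 = 0 & linear_conj S H i1 0 = d *: 'X_i0 ^+ 4].
Proof.
move=> uT T0 T1; pose U := invmx T.
have U0 : \sum_k U i0 k *: map_mpoly f (H k 0) = 0.
  have := combination_linear_conj HL i0 uT; rewrite T0 comp_mpoly0 => e; rewrite -[RHS]e.
  by apply: eq_bigr => k _; rewrite mxE.
have U1 : \sum_k U i1 k *: map_mpoly f (H k 0) = c *: linear_form (row i0 U) ^+ 4.
  have := combination_linear_conj HL i1 uT.
  rewrite T1 comp_mpolyZ rmorphXn /= -linear_form_row => <-.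
  by apply: eq_bigr => k _; rewrite mxE.
have rowUT i : row i U *m T = delta_mx 0 i by rewrite -row_mul mulVmx // row1.
have freeU0 : row_free (row i0 U).
  rewrite -row_leq_rank lt0n mxrank_eq0; apply/eqP => e.
  have /matrixP/(_ 0 i0)/eqP := rowUT i0.
  by rewrite e mul0mx !mxE eqxx eq_sym oner_eq0.
have relU0 (i : 'I_1) : \sum_k row i0 U i k *: map_mpoly f (H k 0) = 0.
  by rewrite -[RHS]U0; apply: eq_bigr => k _; rewrite mxE.
have [l freel rell] := relations_descend (p := fun k => H k 0) freeU0 relU0.
have l0 : l != 0 by rewrite -mxrank_eq0 (eqP freel).
pose q := linear_form l ^+ 4.
have q0 : q != 0 by apply: expf_neq0; apply: contraNneq l0 => /linear_form_eq0 ->.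
(* If row 0 of U is not a multiple of l, it is itself the second relation, with s = 0. If it is x l,
   then row 1 applied to H gives c x^4 times the fourth power of the form l. *)
have [u [s [ul relu]]] : exists (u : 'rV[L]_3) s, ~~ (u <= map_mx f l)%MS /\
    \sum_k u 0 k *: map_mpoly f (H k 0) + s *: map_mpoly f q = 0.
  have [U0l|U0l] := boolP (row i0 U <= map_mx f l)%MS; last first.
    by exists (row i0 U), 0; rewrite scale0r addr0.
  have /sub_rVP[x U0x] := U0l.
  exists (row i1 U), (- c * x ^+ 4); split.
    (* Rows 0 and 1 would be x l and y l; multiplying by T turns y (x l) = x (y l) into a relation
       of unit rows, so y = 0. *)
    apply/negP => /sub_rVP[y U1y].
    have : y *: delta_mx 0 i0 = x *: delta_mx 0 i1 :> 'rV[L]_3.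
      by rewrite -!rowUT U0x U1y -!scalemxAl !scalerA mulrC.
    move=> /matrixP e; have := e 0 i0; have := e 0 i1.
    rewrite !mxE /= !mulr0 !mulr1 => x0 y0.
    have /matrixP/(_ 0 i1)/eqP := rowUT i1.
    by rewrite U1y y0 scale0r mul0mx !mxE eqxx eq_sym oner_eq0.
  have -> : \sum_k row i1 U 0 k *: map_mpoly f (H k 0) = c *: linear_form (row i0 U) ^+ 4.
    by rewrite -U1; apply: eq_bigr => k _; rewrite mxE.
  have -> : linear_form (row i0 U) = x *: map_mpoly f (linear_form l).
    rewrite U0x /linear_form rmorph_sum scaler_sumr /=; apply: eq_bigr => k _.
    by rewrite map_mpolyZ map_mpolyX scalerA !mxE.
  by rewrite exprZn scalerA mulNr scaleNr /q rmorphXn /= addrN.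
have [m [t [ml relm]]] := relation_extend q0 l0 (rell 0) ul relu.
(* The span of l and m has rank at most 2, so some standard row completes them to a basis. *)
have [k ek] : exists k, ~~ (row k 1%:M <= l + m)%MS.
  apply/row_subPn; rewrite sub1mx /row_full; apply: contraTneq isT => e.
  have := (mxrank_adds_leqif l m).1; rewrite e.
  by move=> /leq_trans/(_ (leq_add (rank_leq_row l) (rank_leq_row m))).
pose S := (colmx3 l^T m^T (row k 1%:M)^T)^T.
have uS : S \in unitmx.
  rewrite unitmx_tr; apply: colmx3_unit => x y z e.
  have {}e : x *: l + y *: m + z *: row k 1%:M = 0.
    by apply: trmx_inj; rewrite !linearD !linearZ /= e trmx0.
  have z0 : z = 0.
    apply/eqP; apply: contraNT ek => z0.
    have -> : row k 1%:M = (- (x / z)) *: l + (- (y / z)) *: m :> 'rV[K]_3.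
      apply: (scalerI z0); move/eqP: e; rewrite addrC addr_eq0 => /eqP ->.
      rewrite scalerDr !scalerA !mulrN !(mulrCA z) mulfV // !mulr1 !scaleNr opprD //.
    by rewrite addmx_sub_adds // scalemx_sub.
  move: e; rewrite z0 scale0r addr0 => e.
  have y0 : y = 0.
    apply/eqP; apply: contraNT ml => y0.
    have -> : m = (- (x / y)) *: l.
      apply: (scalerI y0); move/eqP: e; rewrite addrC addr_eq0 => /eqP ->.
      by rewrite scalerA mulrN mulrCA mulfV // mulr1 scaleNr.
    by rewrite scalemx_sub.
  split=> //; move/eqP: e; rewrite y0 scale0r addr0 scaler_eq0 (negPf l0) orbF.
  by move/eqP.
have lE : linear_form l = 'X_i0 \mPo linear_forms S.
  rewrite -linear_form_row; congr linear_form.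
  by apply/rowP => j; rewrite !mxE.
(* The rows of [S] are the new coordinates, so the old ones are substituted through its inverse, and
   the form l becomes x1. *)
exists (invmx S), t; rewrite unitmx_inv uS !linear_conj_combination invmxK; split=> //.
  rewrite (_ : \sum_k _ = 0) ?comp_mpoly0 // -[RHS](rell 0).
  by apply: eq_bigr => j _; rewrite !mxE.
rewrite (_ : \sum_k _ = t *: q); last first.
  by rewrite -relm; apply: eq_bigr => j _; rewrite !mxE.
rewrite comp_mpolyZ /q lE !rmorphXn /= comp_linear_forms mulmxV //.
by rewrite linear_forms1 comp_mpoly_id.
Qed.

Local Notation X1 := ('X_(@Ordinal 3 0 isT)).
Local Notation X2 := ('X_(@Ordinal 3 1 isT)).
Local Notation X3 := ('X_(@Ordinal 3 2 isT)).

(** * Normal forms *)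

Definition binary_quartic (K : fieldType) (c0 c1 c2 c3 c4 : K) (x y : {mpoly K[3]}) :=
  c0 *: x ^+ 4 + c1 *: (x ^+ 3 * y) + c2 *: (x ^+ 2 * y ^+ 2) + c3 *: (x * y ^+ 3)
    + c4 *: y ^+ 4.

(** Differentiation in x3 multiplies coefficients by exponents from 1 to 4, all invertible, so every
    coefficient involving x3 is 0. *)
Lemma quartic_without_x3 (K : fieldType) (n2 : 2%:R != 0 :> K) (n3 : 3%:R != 0 :> K)
    (p : {mpoly K[3]}) : p \is 4.-homog -> p^`M(i2) = 0 ->
  exists c0 c1 c2 c3 c4, p = binary_quartic c0 c1 c2 c3 c4 X1 X2.
Proof.
move=> hp dp; exists (dcoef p 0 0), (dcoef p 1 0), (dcoef p 2 0), (dcoef p 3 0), (dcoef p 4 0).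
have [_ _ d2] := dcoef_mderiv hp.
have p0 j k : dcoef p j k.+1 = 0.
  have [jk|jk] := leqP (j + k.+1) 4; last by rewrite (dcoef_homog _ _ hp) leqNgt jk.
  have /eqP := d2 j k; rewrite dp dcoef0 eq_sym /coefd2 -mulr_natr mulf_eq0.
  case/orP=> [/eqP//|].
  by case: k jk => [|[|[|[|k]]]] jk; rewrite ?oner_eq0 ?(negPf n2) ?(negPf n3)
    ?(natrM _ 2 2) ?mulf_eq0 ?(negPf n2) //; lia.
apply/eqP; rewrite -subr_eq0; apply/eqP; apply: (@dcoef_homog_inj _ 4).
  apply: rpredB; first exact: hp.
  rewrite /binary_quartic !mpolyXn -!mpolyXD.
  do 4! (try apply: rpredD); apply: dhomogZ; rewrite dhomogX /= ?mdegD ?mdegMn ?mdeg1 //.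
move=> j k; rewrite /binary_quartic !mpolyXn -!mpolyXD !(dcoefD, dcoefN, dcoefZ) !dcoefX.
rewrite !mnmDE !mnm1E /=.
case: k => [|k]; last by rewrite p0 !andbF !mulr0 !addr0 subrr.
case: j => [|[|[|[|[|j]]]]] /=; rewrite ?mulr0 ?mulr1 ?addr0 ?add0r ?subrr //.
by rewrite subr0 (dcoef_homog _ _ hp).
Qed.

Definition mx3 (R : nzRingType) (rows : seq (seq R)) : 'M[R]_3 :=
  \matrix_(i, j) nth 0 (nth [::] rows i) j.

Lemma comp_X_linear_forms (K : fieldType) (T : 'M[K]_3) i :
  'X_i \mPo linear_forms T = T i i0 *: X1 + T i i1 *: X2 + T i i2 *: X3.
Proof. by rewrite comp_mpolyXU -tnth_nth tnth_mktuple sum_ord3 addrA. Qed.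

Lemma subst_polymap3 (K : fieldType) (T : 'M[K]_3) f1 f2 f3 (g1 g2 g3 : {mpoly K[3]}) :
  f1 \mPo linear_forms T = T i0 i0 *: g1 + T i0 i1 *: g2 + T i0 i2 *: g3 ->
  f2 \mPo linear_forms T = T i1 i0 *: g1 + T i1 i1 *: g2 + T i1 i2 *: g3 ->
  f3 \mPo linear_forms T = T i2 i0 *: g1 + T i2 i1 *: g2 + T i2 i2 *: g3 ->
  subst_linear T (polymap3 f1 f2 f3) = map_mx (@mpolyC 3 K) T *m polymap3 g1 g2 g3.
Proof.
move=> e1 e2 e3; apply/colP; apply: forall_ord3; rewrite !mxE -/(linear_forms T) /=;
  by rewrite sum_ord3 !mxE /= !mul_mpolyC addrA.
Qed.

Lemma comp_mpoly_mul (K : fieldType) n (t : n.-tuple {mpoly K[n]}) p q :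
  (p * q) \mPo t = (p \mPo t) * (q \mPo t).
Proof. exact: rmorphM. Qed.

Lemma comp_mpoly_exp (K : fieldType) n (t : n.-tuple {mpoly K[n]}) p k :
  (p ^+ k) \mPo t = (p \mPo t) ^+ k.
Proof. exact: rmorphXn. Qed.

Lemma comp_binary_quartic (K : fieldType) (T : 'M[K]_3) c0 c1 c2 c3 c4 x y :
  binary_quartic c0 c1 c2 c3 c4 x y \mPo linear_forms T =
  binary_quartic c0 c1 c2 c3 c4 (x \mPo linear_forms T) (y \mPo linear_forms T).
Proof.
rewrite /binary_quartic 4!comp_mpolyD.
congr (_ + _ + _ + _ + _); rewrite [LHS]comp_mpolyZ; congr (_ *: _).
- exact: comp_mpoly_exp.
- by rewrite [LHS]comp_mpoly_mul comp_mpoly_exp.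
- by rewrite [LHS]comp_mpoly_mul !comp_mpoly_exp.
- by rewrite [LHS]comp_mpoly_mul comp_mpoly_exp.
- exact: comp_mpoly_exp.
Qed.

Lemma scale_div3 (K : fieldType) (V : lmodType K) (a b c d : K) (x y z t : V) :
  a != 0 ->
  a *: (x + (b / a) *: y + (c / a) *: z + (d / a) *: t) =
  a *: x + b *: y + c *: z + d *: t.
Proof. by move=> a0; rewrite !scalerDr !scalerA !(mulrC a) !divfK. Qed.

(* x1 = y1, x2 = s y1 + m y2, x3 = r y2 + n y3: here s makes the coefficient of
   y1^3 y2 nonzero, r removes y1^4 from the last component, m and n rescale. *)
Lemma normal_form_triangular (K : fieldType) (n2 : 2%:R != 0 :> K) (d c0 c1 c2 c3 c4 s : K)
    (H := polymap3 0 (d *: X1 ^+ 4) (binary_quartic c0 c1 c2 c3 c4 X1 X2) : polymap 3 K) :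
  d != 0 ->
  c1 + 2%:R * c2 * s + 3%:R * c3 * s ^+ 2 + 4%:R * c4 * s ^+ 3 != 0 ->
  exists T : 'M[K]_3, T \in unitmx /\ exists u v w : K,
    linear_conj T H = polymap3 0 (4%:R^-1 *: X1 ^+ 4)
      (X1 ^+ 3 * X2 + u *: (X1 ^+ 2 * X2 ^+ 2) + v *: (X1 * X2 ^+ 3) + w *: X2 ^+ 4).
Proof.
move=> d0; set e := (X in X != 0) => e0.
have n4 : 4%:R != 0 :> K by rewrite (natrM _ 2 2) mulf_neq0.
pose m := 4%:R * d; pose n := m * e.
have n0 : n != 0 by rewrite !mulf_neq0.
pose r := 4%:R * (c0 + c1 * s + c2 * s ^+ 2 + c3 * s ^+ 3 + c4 * s ^+ 4).
pose T := mx3 [:: [:: 1; 0; 0]; [:: s; m; 0]; [:: 0; r; n]].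
have uT : T \in unitmx.
  by rewrite unitmxE det_mx33 !mxE /= unitfE !(mul0r, mulr0, mul1r, subr0, addr0) !mulf_neq0.
exists T; split=> //.
(* Coefficients of the binary form at (y1, s y1 + m y2), divided by n, which is itself the
   coefficient of y1^3 y2. *)
exists (m ^+ 2 * (c2 + 3%:R * c3 * s + 6%:R * c4 * s ^+ 2) / n),
  (m ^+ 3 * (c3 + 4%:R * c4 * s) / n), (m ^+ 4 * c4 / n).
apply: linear_conj_unique => //; apply: subst_polymap3.
- by rewrite comp_mpoly0 !mxE /= scaler0 !scale0r !addr0.
- rewrite comp_mpolyZ comp_mpoly_exp comp_X_linear_forms !mxE /= !scale0r scale1r !addr0.
  by rewrite scaler0 add0r scalerA /m [4%:R * d]mulrC mulfK.
rewrite comp_binary_quartic !comp_X_linear_forms !mxE /= !scale0r scale1r !addr0.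
rewrite scale_div3 // scalerA /r [4%:R * _]mulrC mulfK //.
rewrite /binary_quartic /n /e -!mul_mpolyC.
ring.
Qed.

(* x1 = y1 + t y3, x2 = s y1 + (1 + s t) y3, x3 = n y2: here s makes the
   coefficient of y1^4 nonzero and t removes y1^3 y3. *)
Lemma normal_form_binary (K : fieldType) (n2 : 2%:R != 0 :> K) (c0 c1 c2 c3 c4 s : K)
    (H := polymap3 0 0 (binary_quartic c0 c1 c2 c3 c4 X1 X2) : polymap 3 K) :
  c0 + c1 * s + c2 * s ^+ 2 + c3 * s ^+ 3 + c4 * s ^+ 4 != 0 ->
  exists T : 'M[K]_3, T \in unitmx /\ exists u v w : K,
    linear_conj T H = polymap3 0
      (4%:R^-1 *: X1 ^+ 4 + u *: (X1 ^+ 2 * X3 ^+ 2) + v *: (X1 * X3 ^+ 3) + w *: X3 ^+ 4) 0.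
Proof.
set e := (X in X != 0) => e0.
have n4 : 4%:R != 0 :> K by rewrite (natrM _ 2 2) mulf_neq0.
pose n := 4%:R * e; have n0 : n != 0 by rewrite mulf_neq0.
pose t := - (c1 + 2%:R * c2 * s + 3%:R * c3 * s ^+ 2 + 4%:R * c4 * s ^+ 3) / n.
pose p := 1 + s * t.
have tn : (c1 + 2%:R * c2 * s + 3%:R * c3 * s ^+ 2 + 4%:R * c4 * s ^+ 3) = - (t * n).
  by rewrite /t divfK // opprK.
pose T := mx3 [:: [:: 1; 0; t]; [:: s; 0; p]; [:: 0; n; 0]].
have uT : T \in unitmx.
  have detT : \det T = - n by rewrite det_mx33 !mxE /= /p; ring.
  by rewrite unitmxE unitfE detT oppr_eq0.
exists T; split=> //.
(* u, v, w are the coefficients of y1^2 y3^2, y1 y3^3, y3^4 after the substitution. *)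
pose u := c0 * (6%:R * t ^+ 2) + c1 * (3%:R * t ^+ 2 * s + 3%:R * t * p)
  + c2 * (t ^+ 2 * s ^+ 2 + 4%:R * t * s * p + p ^+ 2)
  + c3 * (3%:R * t * s ^+ 2 * p + 3%:R * s * p ^+ 2) + c4 * (6%:R * s ^+ 2 * p ^+ 2).
pose v := c0 * (4%:R * t ^+ 3) + c1 * (t ^+ 3 * s + 3%:R * t ^+ 2 * p)
  + c2 * (2%:R * t ^+ 2 * s * p + 2%:R * t * p ^+ 2)
  + c3 * (3%:R * t * s * p ^+ 2 + p ^+ 3) + c4 * (4%:R * s * p ^+ 3).
pose w := c0 * t ^+ 4 + c1 * t ^+ 3 * p + c2 * t ^+ 2 * p ^+ 2 + c3 * t * p ^+ 3 + c4 * p ^+ 4.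
exists (u / n), (v / n), (w / n).
have x1x3 : n * t + (c1 + 2%:R * c2 * s + 3%:R * c3 * s ^+ 2 + 4%:R * c4 * s ^+ 3) = 0.
  by rewrite tn mulrC subrr.
apply: linear_conj_unique => //; apply: subst_polymap3.
- by rewrite comp_mpoly0 !mxE /= !scaler0 !scale0r !addr0.
- by rewrite comp_mpoly0 !mxE /= !scaler0 !scale0r !addr0.
rewrite comp_binary_quartic !comp_X_linear_forms !mxE /= !scale0r ?scale1r ?addr0 ?add0r.
rewrite scale_div3 // scalerA /n [4%:R * _]mulrC mulfK //.
(* The left side of [x1x3] is the coefficient of y1^3 y3 after the substitution; inserting this zero
   term makes the two sides formally equal. *)
rewrite -[RHS]addr0 -(scale0r (X1 ^+ 3 * X3)) -x1x3.
rewrite /binary_quartic /u /v /w /n /e /p -!mul_mpolyC.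
ring.
Qed.

(** H is x1^4 times the constant vector (0, d, c0), and the second column of T is 4 times that
    vector. *)
Lemma normal_form_power (K : fieldType) (n2 : 2%:R != 0 :> K) (d c0 : K)
    (H := polymap3 0 (d *: X1 ^+ 4) (binary_quartic c0 0 0 0 0 X1 X2) : polymap 3 K) :
  d != 0 -> exists T : 'M[K]_3, T \in unitmx /\ exists u v w : K,
    linear_conj T H = polymap3 0
      (4%:R^-1 *: X1 ^+ 4 + u *: (X1 ^+ 2 * X3 ^+ 2) + v *: (X1 * X3 ^+ 3) + w *: X3 ^+ 4) 0.
Proof.
move=> d0; have n4 : 4%:R != 0 :> K by rewrite (natrM _ 2 2) mulf_neq0.
pose T := mx3 [:: [:: 1; 0; 0]; [:: 0; d * 4%:R; 0]; [:: 0; c0 * 4%:R; 1]].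
have uT : T \in unitmx.
  have detT : \det T = d * 4%:R by rewrite det_mx33 !mxE /=; ring.
  by rewrite unitmxE unitfE detT mulf_neq0.
exists T; split=> //; exists 0, 0, 0; rewrite !scale0r !addr0.
apply: linear_conj_unique => //; apply: subst_polymap3; rewrite ?comp_binary_quartic
  ?comp_mpolyZ ?comp_mpoly_exp ?comp_mpoly0 ?comp_X_linear_forms !mxE /=.
- by rewrite !scaler0 scale0r !addr0.
- by rewrite !scaler0 !scale0r !addr0 add0r scale1r scalerA mulfK.
rewrite !scaler0 !scale0r !addr0 !add0r scale1r scalerA mulfK //.
by rewrite /binary_quartic !scale0r !addr0.
Qed.

(** Interpolation at 0, 1, -1 and 2 recovers the coefficients with 2 and 6 as the only divisors. *)
Lemma cubic_nonroot (K : fieldType) (n2 : 2%:R != 0 :> K) (n3 : 3%:R != 0 :> K)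
    (b0 b1 b2 b3 : K) : ~ (b0 = 0 /\ b1 = 0 /\ b2 = 0 /\ b3 = 0) ->
  exists s, b0 + b1 * s + b2 * s ^+ 2 + b3 * s ^+ 3 != 0.
Proof.
move=> nz; pose g s := b0 + b1 * s + b2 * s ^+ 2 + b3 * s ^+ 3.
have [g0|] := eqVneq (g 0) 0; last by exists 0.
have [g1|] := eqVneq (g 1) 0; last by exists 1.
have [gN|] := eqVneq (g (- 1)) 0; last by exists (- 1).
have [g2|] := eqVneq (g 2%:R) 0; last by exists 2%:R.
case: nz; have e0 : b0 = 0 by rewrite -g0 /g; ring.
have nz := natr_smooth_neq0 n2 n3.
have e2 : b2 = 0.
  apply: (eq_of_scaled (nz 1%N 0%N) (e := g 1 + g (- 1))); first by rewrite g1 gN addr0.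
  by rewrite /g e0; ring.
have e3 : b3 = 0.
  apply: (eq_of_scaled (nz 1%N 1%N) (e := g 2%:R - 2%:R * g 1)).
    by rewrite g1 g2 mulr0 subr0.
  by rewrite /g e0 e2; ring.
have e1 : b1 = 0 by rewrite -g1 /g e0 e2 e3; ring.
by [].
Qed.

(** The points 0, 1, -1, 2, -2 are distinct in characteristic other than 2 and 3, and exhaust the
    field with five elements. Interpolation there divides only by 24, 12 and 2. *)
Lemma quartic_nonroot (K : fieldType) (n2 : 2%:R != 0 :> K) (n3 : 3%:R != 0 :> K)
    (c0 c1 c2 c3 c4 : K) : ~ (c0 = 0 /\ c1 = 0 /\ c2 = 0 /\ c3 = 0 /\ c4 = 0) ->
  exists s, c0 + c1 * s + c2 * s ^+ 2 + c3 * s ^+ 3 + c4 * s ^+ 4 != 0.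
Proof.
move=> nz; pose g s := c0 + c1 * s + c2 * s ^+ 2 + c3 * s ^+ 3 + c4 * s ^+ 4.
have [g0|] := eqVneq (g 0) 0; last by exists 0.
have [g1|] := eqVneq (g 1) 0; last by exists 1.
have [gN|] := eqVneq (g (- 1)) 0; last by exists (- 1).
have [g2|] := eqVneq (g 2%:R) 0; last by exists 2%:R.
have [gM|] := eqVneq (g (- 2%:R)) 0; last by exists (- 2%:R).
case: nz; have e0 : c0 = 0 by rewrite -g0 /g; ring.
have nz := natr_smooth_neq0 n2 n3.
have e4 : c4 = 0.
  apply: (eq_of_scaled (nz 3%N 1%N)
    (e := g 2%:R + g (- 2%:R) - 4%:R * (g 1 + g (- 1)))).
    by rewrite g1 gN g2 gM !addr0 mulr0 subr0.
  by rewrite /g e0; ring.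
have e3 : c3 = 0.
  apply: (eq_of_scaled (nz 2%N 1%N)
    (e := g 2%:R - g (- 2%:R) - 2%:R * (g 1 - g (- 1)))).
    by rewrite g1 gN g2 gM !subr0 mulr0 subr0.
  by rewrite /g; ring.
have e2 : c2 = 0.
  apply: (eq_of_scaled (nz 1%N 0%N) (e := g 1 + g (- 1))); first by rewrite g1 gN addr0.
  by rewrite /g e0 e4; ring.
have e1 : c1 = 0 by rewrite -g1 /g e0 e2 e3 e4; ring.
by [].
Qed.

(** * Assembly of the classification *)

Theorem corollary6p2 (K : fieldType) (H : polymap 3 K)
    (Hquartic : quartic_homogeneous H)
    (Hnilp : nilpotent_mx (jacobian H))
    (char_neq2 : 2%N \notin [pchar K])
    (char_neq3 : 3%N \notin [pchar K]) :
  exists T : 'M[K]_3, T \in unitmx /\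
    let x1 : {mpoly K[3]} := 'X_(@Ordinal 3 0 isT) in
    let x2 : {mpoly K[3]} := 'X_(@Ordinal 3 1 isT) in
    let x3 : {mpoly K[3]} := 'X_(@Ordinal 3 2 isT) in
    (exists u3 high3 w3 : K,
        linear_conj T H =
        polymap3 0
          (4%:R^-1 *: x1 ^+ 4)
          (x1 ^+ 3 * x2 + u3 *: (x1 ^+ 2 * x2 ^+ 2)
             + high3 *: (x1 * x2 ^+ 3) + w3 *: x2 ^+ 4))
    \/
    (exists u2 high2 w2 : K,
        linear_conj T H =
        polymap3 0
          (4%:R^-1 *: x1 ^+ 4 + u2 *: (x1 ^+ 2 * x3 ^+ 2)
             + high2 *: (x1 * x3 ^+ 3) + w2 *: x3 ^+ 4)
          0).
Proof.
have n2 : 2%:R != 0 :> K by move: char_neq2; rewrite inE.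
have n3 : 3%:R != 0 :> K by move: char_neq3; rewrite inE.
have [degH homH] := Hquartic.
have hH i : H i 0 \is 4.-homog.
  by have [->|/homH//] := eqVneq (H i 0) 0; rewrite dhomog0.
have H0 : H != 0.
  apply: contra_eq_neq degH => ->; rewrite /polymap_deg big1 // => i _.
  by rewrite mxE msize0.
have inj : injective (@tofrac {mpoly K[3]}) by move=> p q /eqP; rewrite tofrac_eq => /eqP.
have [T [c [uT T0 T1]]] :=
  triangular_generic (tau := @tofrac {mpoly K[3]}) n2 n3 inj hH H0 Hnilp.
have [S [d [uS S0 S1]]] := triangular_descend uT T0 T1.
have hS := homog_linear_conj S hH.
(* The first two diagonal entries of the Jacobian matrix vanish, since the components are 0 and a
   multiple of x1^4; the zero trace leaves the third. *)
have dS : (linear_conj S H i2 0)^`M(i2) = 0.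
  have := mxtrace_nilpotent (nilpotent_linear_conj uS Hnilp).
  rewrite /mxtrace sum_ord3 ![jacobian _ _ _]mxE S0 S1 mderiv0 add0r.
  rewrite mpolyXn mderivZ mderivX mulmnE mnm1E /= ?muln0.
  by rewrite scale0r scaler0 add0r.
have [c0 [c1 [c2 [c3 [c4 S2]]]]] := quartic_without_x3 n2 n3 (hS i2) dS.
have SE : linear_conj S H = polymap3 0 (d *: X1 ^+ 4) (binary_quartic c0 c1 c2 c3 c4 X1 X2).
  by apply/colP; apply: forall_ord3; rewrite ?S0 ?S1 ?S2 mxE.
have SH0 := linear_conj_neq0 uS H0.
have lift T' : T' \in unitmx -> linear_conj T' (linear_conj S H) = linear_conj (S *m T') H.
  by move=> uT'; rewrite linear_conj_comp.
suff [T' [uT' form]] : exists T' : 'M[K]_3, T' \in unitmx /\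
    ((exists u v w : K, linear_conj T' (linear_conj S H) = polymap3 0 (4%:R^-1 *: X1 ^+ 4)
      (X1 ^+ 3 * X2 + u *: (X1 ^+ 2 * X2 ^+ 2) + v *: (X1 * X2 ^+ 3) + w *: X2 ^+ 4)) \/
    (exists u v w : K, linear_conj T' (linear_conj S H) = polymap3 0
      (4%:R^-1 *: X1 ^+ 4 + u *: (X1 ^+ 2 * X3 ^+ 2) + v *: (X1 * X3 ^+ 3) + w *: X3 ^+ 4) 0)).
  by exists (S *m T'); rewrite unitmx_mul uS uT' -lift.
rewrite SE in SH0 *.
(* For d = 0 only the third component remains, a nonzero binary quartic. For nonzero d the form
   depends on whether that component is a multiple of x1^4. *)
have [d0|d0] := eqVneq d 0.
  have [|s es] := quartic_nonroot n2 n3 (c0 := c0) (c1 := c1) (c2 := c2) (c3 := c3) (c4 := c4).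
    case=> e0 [e1 [e2 [e3 e4]]]; case/eqP: SH0.
    apply/colP; apply: forall_ord3; rewrite !mxE //= ?d0 ?scale0r //.
    by rewrite e0 e1 e2 e3 e4 /binary_quartic !scale0r !addr0.
  rewrite d0 scale0r; have [T' [uT' form]] := normal_form_binary n2 es.
  by exists T'; split=> //; right.
have [cz|cnz] := boolP [&& c1 == 0, c2 == 0, c3 == 0 & c4 == 0].
  case/and4P: cz => /eqP-> /eqP-> /eqP-> /eqP->.
  have [T' [uT' form]] := normal_form_power n2 c0 d0.
  by exists T'; split=> //; right.
have n4 : 4%:R != 0 :> K by rewrite (natrM _ 2 2) mulf_neq0.
(* This cubic is the derivative in s of the last component at (1, s); as 2, 3, 4 are invertible, it
   is zero only if c1, c2, c3, c4 are. *)
have [|s es] := cubic_nonroot n2 n3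
  (b0 := c1) (b1 := 2%:R * c2) (b2 := 3%:R * c3) (b3 := 4%:R * c4).
  case=> /eqP e1 [/eqP e2 [/eqP e3 /eqP e4]]; case/negP: cnz; move: e2 e3 e4.
  by rewrite e1 !mulf_eq0 (negPf n2) (negPf n3) (negPf n4) /= => -> -> ->.
have [T' [uT' form]] := normal_form_triangular n2 c0 d0 es.
by exists T'; split=> //; left.
Qed.
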